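(* Let $X$ be a normed linear space and $Y$ a Banach space such that the pair $(X,Y)$ has property (LA$_1$). Let $U\subset X$ be an open set with property (WQ) such that the pair $(\overline U,Y)$ has property (LLE). Let $f\in C^1(U;Y)$. Then $f$ can be extended to an $F\in C^1(X;Y)$ if and only if the mapping $Df\colon U\to\mathcal L(X;Y)$ has a continuous extension $G\colon\overline U\to\mathcal L(X;Y)$.
   Context: All normed linear spaces are real. $U(x,r)$ is the open ball with centre $x$ and radius $r$, $U_X$ is the open unit ball of $X$. An $L$-Lipschitz mapping is a mapping with a (not necessarily minimal) Lipschitz constant $L$. $\mathcal L(X;Y)$ is the normed space of continuous linear operators from $X$ to $Y$. $Df$ is the Fréchet derivative. For open $\Omega\subset X$, $C^k(\Omega;Y)$ is the space of $C^k$-smooth (in the Fréchet sense) mappings from $\Omega$ to $Y$. Property (WQ): a subset $U$ of a metric space $(X,\rho)$ has property (WQ) if for each $a\in\partial U$ there exist $r>0$ and $c\ge1$ such that for each $x,y\in U\cap U(a,r)$ there exists a continuous rectifiable curve $\gamma\colon[0,1]\to U$ such that $\gamma(0)=x$, $\gamma(1)=y$, and $\operatorname{len}\gamma\le c\rho(x,y)$, where $\operatorname{len}\gamma$ is the length of $\gamma$. Property (LLE): for normed linear spaces $X,Y$ and $A\subset X$, the pair $(A,Y)$ has property (LLE) if for every $x\in A$ there is $K\ge1$ such that for each $\delta>0$ there is an open neighbourhood $U$ of $x$ (in $X$) such that $U\subset U(x,\delta)$ and each $Q$-Lipschitz mapping from $U\cap A$ to $Y$ can be extended to a $KQ$-Lipschitz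 mapping on $U$. Property (LA$_k$), $k\in\mathbb N\cup\{\infty\}$: the pair $(X,Y)$ of normed linear spaces has property (LA$_k$) if there is $C\ge0$ such that for any $L$-Lipschitz mapping $f\colon U_X\to Y$ and any $\varepsilon>0$ there is a $CL$-Lipschitz mapping $g\in C^k(U_X;Y)$ such that $\sup_{U_X}\|f-g\|\le\varepsilon$. *)

(* Defs.v *)
From HB Require Import structures.
From mathcomp Require Import all_boot all_order all_algebra.
From mathcomp Require Import all_classical all_reals all_analysis.

Set Implicit Arguments.
Unset Strict Implicit.
Unset Printing Implicit Defensive.
Import Order.TTheory GRing.Theory Num.Theory.
Import numFieldNormedType.Exports.

Local Open Scope classical_set_scope.
Local Open Scope ring_scope.

(* Mappings defined on a subset of X are represented by total functions X -> Y
   whose values outside that subset are irrelevant. *)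

Section ContinuousLinear.
Context {R : realType} (X Y : normedModType R).

(* clin X Y is the space L(X; Y), normed by the operator norm. *)
Definition clin_pred : {pred X -> Y} :=
  fun T => `[< linear T /\ continuous T >].

Record clin := Clin {
  clin_fun :> X -> Y ;
  clin_funP : clin_fun \in clin_pred }.

HB.instance Definition _ := [isSub for clin_fun].
HB.instance Definition _ := [Choice of clin by <:].

Lemma clin_submod_closed : submod_closed clin_pred.
Proof.
split.
  apply/asboolP; split; last exact: cst_continuous.
  by move=> a u v /=; rewrite scaler0 addr0.
move=> a S T /asboolP[Sl Sc] /asboolP[Tl Tc]; apply/asboolP; split.
  move=> b u v; rewrite !fctE Sl Tl !scalerDr !scalerA (mulrC a b) !addrA.
  by congr (_ + _); rewrite addrAC.
by move=> x; apply: cvgD; [apply: cvgZl_tmp; exact: Sc|exact: Tc].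
Qed.

HB.instance Definition _ :=
  GRing.isSubmodClosed.Build R (X -> Y) clin_pred clin_submod_closed.
HB.instance Definition _ := [SubChoice_isSubLmodule of clin by <:].

Lemma clin_linear (T : clin) : linear T.
Proof. by have /asboolP[] := clin_funP T. Qed.

Lemma clin_continuous (T : clin) : continuous T.
Proof. by have /asboolP[] := clin_funP T. Qed.

HB.instance Definition _ (T : clin) :=
  GRing.isLinear.Build R X Y _ T (clin_linear T).

Definition opnorm (T : clin) : R :=
  sup [set `|T x| | x in [set x : X | `|x| <= 1]].

Lemma opnorm_has_sup (T : clin) :
  has_sup [set `|T x| | x in [set x : X | `|x| <= 1]].
Proof.
split; first by exists `|T 0|, 0 => //=; rewrite normr0.
have /linear_bounded_continuous/linear_boundedP := @clin_continuous T.
move=> /pinfty_ex_gt0[r r0 Tr]; exists r => _ [x /= x1 <-].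
by rewrite (le_trans (Tr x))// ger_pMr.
Qed.

Lemma opnorm_ub (T : clin) (x : X) : `|T x| <= opnorm T * `|x|.
Proof.
have [->|x0] := eqVneq x 0; first by rewrite linear0 !normr0 mulr0.
have nx0 : 0 < `|x| by rewrite normr_gt0.
rewrite -ler_pdivrMr//.
suff -> : `|T x| / `|x| = `|T (`|x|^-1 *: x)|.
  apply: ub_le_sup; first by case: (opnorm_has_sup T).
  exists (`|x|^-1 *: x) => //=.
  by rewrite normrZ ger0_norm ?invr_ge0// mulVf// gt_eqF.
by rewrite linearZ normrZ ger0_norm ?invr_ge0// mulrC.
Qed.

Lemma opnorm_le (T : clin) (c : R) :
  (forall x : X, `|x| <= 1 -> `|T x| <= c) -> opnorm T <= c.
Proof.
move=> Tc; apply: ge_sup; first by case: (opnorm_has_sup T).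
by move=> _ [x /= x1 <-]; exact: Tc.
Qed.

Lemma opnorm_ge0 (T : clin) : 0 <= opnorm T.
Proof.
apply: (le_trans (normr_ge0 (T 0))); apply: ub_le_sup.
  by case: (opnorm_has_sup T).
by exists 0 => //=; rewrite normr0.
Qed.

Lemma opnormD (S T : clin) : opnorm (S + T) <= opnorm S + opnorm T.
Proof.
apply: opnorm_le => x x1; rewrite (le_trans (ler_normD _ _))//.
by apply: lerD; apply: (le_trans (opnorm_ub _ _));
  rewrite ler_piMr// opnorm_ge0.
Qed.

Let opnormZ_le (a : R) (T : clin) : opnorm (a *: T) <= `|a| * opnorm T.
Proof.
apply: opnorm_le => x x1; rewrite [(a *: T) x]/(a *: T x) normrZ.
by rewrite ler_wpM2l// (le_trans (opnorm_ub _ _))// ler_piMr// opnorm_ge0.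
Qed.

Lemma opnormZ (a : R) (T : clin) : opnorm (a *: T) = `|a| * opnorm T.
Proof.
apply/eqP; rewrite eq_le opnormZ_le /=.
have [->|a0] := eqVneq a 0; first by rewrite normr0 mul0r opnorm_ge0.
have na0 : 0 < `|a| by rewrite normr_gt0.
rewrite -ler_pdivlMl// -normfV.
by have := opnormZ_le a^-1 (a *: T); rewrite scalerA mulVf// scale1r.
Qed.

Lemma opnorm0_eq0 (T : clin) : opnorm T = 0 -> T = 0.
Proof.
move=> T0; apply/val_inj/funext => x; apply/eqP; rewrite -normr_le0.
by rewrite (le_trans (opnorm_ub T x))// T0 mul0r.
Qed.

HB.instance Definition _ :=
  Lmodule_isNormed.Build R clin opnormD opnormZ opnorm0_eq0.

End ContinuousLinear.

Section Smoothness.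
Context {R : realType} {X : normedModType R}.

(* Fréchet derivative as a map into L(X; Y); it is 0 where 'd f x is not
   continuous, which does not happen when f is differentiable at x. *)
Definition frechet {Y : normedModType R} (f : X -> Y) (x : X) : clin X Y :=
  insubd 0 ('d f x : X -> Y).

Lemma frechetE {Y : normedModType R} (f : X -> Y) (x : X) :
  differentiable f x -> frechet f x = 'd f x :> (X -> Y).
Proof.
move=> fx; rewrite /frechet val_insubd ifT//; apply/asboolP; split.
  exact: linearP.
exact: diff_continuous.
Qed.

(* f \in C^n(U; Y), for U open *)
Fixpoint Cn (n : nat) {Y : normedModType R} (U : set X) (f : X -> Y) : Prop :=
  if n is m.+1 then
    (forall x, U x -> differentiable f x) /\ Cn m U (frechet f)
  else {within U, continuous f}.

(* f \in C^k(U; Y), with None standing for k = oo *)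
Definition Ck (k : option nat) {Y : normedModType R} (U : set X) (f : X -> Y) :=
  if k is Some n then Cn n U f else forall n, Cn n U f.

End Smoothness.

Section Curves.
Context {R : realType} {X : normedModType R}.

(* Length of gamma restricted to [0, 1]; itv_partition 0 1 s means that 0 :: s is
   strictly increasing from 0 to 1. *)
Definition curve_length (gamma : R -> X) : \bar R :=
  ereal_sup [set (\sum_(i < size s)
      `|gamma (nth 0 (0 :: s) i.+1) - gamma (nth 0 (0 :: s) i)|)%:E
    | s in itv_partition 0 1].

Definition WQ (U : set X) : Prop :=
  forall a : X, (closure U `\` U°) a ->
  exists r c : R, [/\ 0 < r, 1 <= c &
    forall x y : X, (U `&` ball a r) x -> (U `&` ball a r) y ->
    exists gamma : R -> X,
      [/\ {within `[0, 1], continuous gamma},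
          forall t, `[0, 1]%classic t -> U (gamma t),
          gamma 0 = x /\ gamma 1 = y,
          (curve_length gamma < +oo)%E &
          (curve_length gamma <= (c * `|x - y|)%:E)%E]].

End Curves.

Section PairProperties.
Context {R : realType}.

(* The library's k.-lipschitz_A allows k < 0 when A has at most one point. *)
Definition Lipschitz_mapping {X Y : normedModType R} (L : R) (A : set X)
    (f : X -> Y) : Prop :=
  0 <= L /\ L.-lipschitz_A f.

Definition sup_dist {X Y : normedModType R} (A : set X) (f g : X -> Y) : \bar R :=
  ereal_sup [set `|f x - g x|%:E | x in A].

Definition LLE (X : normedModType R) (A : set X) (Y : normedModType R) : Prop :=
  forall x : X, A x -> exists K : R, 1 <= K /\
  forall delta : R, 0 < delta ->
  exists U : set X, [/\ open_nbhs x U, U `<=` ball x delta &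
    forall (Q : R) (f : X -> Y), Lipschitz_mapping Q (U `&` A) f ->
    exists g : X -> Y, Lipschitz_mapping (K * Q) U g /\
      forall z, (U `&` A) z -> g z = f z].

Definition LA (k : option nat) (X Y : normedModType R) : Prop :=
  exists C : R, 0 <= C /\
  forall (L : R) (f : X -> Y), Lipschitz_mapping L (ball 0 1) f ->
  forall eps : R, 0 < eps ->
  exists g : X -> Y, [/\ Lipschitz_mapping (C * L) (ball 0 1) g,
    Ck k (ball 0 1) g &
    (sup_dist (ball 0 1)%R f g <= eps%:E)%E].

End PairProperties.

(* Main.v *)
Require Import Defs.
From HB Require Import structures.
From mathcomp Require Import all_boot all_order all_algebra.
From mathcomp Require Import all_classical all_reals all_analysis.
From mathcomp Require Import wochoice ring lra.
Import Order.TTheory GRing.Theory Num.Theory.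
Import numFieldNormedType.Exports.
Local Open Scope classical_set_scope.
Local Open Scope ring_scope.

(** If [F] is a C^1 extension of [f], then the derivative of [F] extends that of [f].
    The converse is a Whitney extension theorem on [A], the closure of [U].

    Throughout, continuous differentiability is replaced by strict
    differentiability: [T] is the strict derivative of [f] at [x] if [f - T] has
    arbitrarily small Lipschitz constants on small balls around [x]. On an open
    set the two notions agree ([Ck1_sderiv], [sdiff_Ck1]), and every estimate
    becomes one about Lipschitz constants.

    Near a point [a] of [A] the derivative of [f - G a] is small. Integrating it
    along the short curves provided by the hypothesis on [U] shows that [f - G a]
    has small Lipschitz constants on the part of [U] near [a]. So [f] extends
    continuously to [A] and satisfies the Whitney condition there
    ([whitney_closure]).

    By the local Lipschitz extension property, [f - G x] extends from [A] to a
    neighbourhood of [x] with a Lipschitz constant as small as desired; the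
    constant [K] of that property depends on [x], but is absorbed because the
    Whitney condition holds with every [e]. A partition of unity glues the local
    extensions into a [g] such that [g - G a] has Lipschitz constant [e] near
    each [a] in [A] ([approximate_extension]). The error is then removed: the
    extensions for [e = 2^-1 ^+ n] are joined by a telescoping sum whose terms
    are cut off outside a neighbourhood of [A] that depends on [n]. The cut-offs have
    derivative of order [(dist A)^-1], and the terms they multiply are of order
    [e * dist A], so the truncated terms are globally Lipschitz with summable
    constants ([truncation], [exact_extension]). The sum extends [f] and has
    strict derivative [G a] at each [a] in [A]. Finally it is smoothed off [A],
    by gluing smooth approximations on balls whose radius is comparable with the
    distance to [A] ([smoothing]).

    Smooth partitions of unity on a possibly nonseparable [X] come from the
    approximation property of the pair [(X, Y)]. A norming functional of [Y]
    makes it apply to real functions, in particular to distance functions, which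
    yields smooth bumps ([bump]). A well-ordering of the index set, as in
    M. E. Rudin's proof that metric spaces are paracompact, reduces an arbitrary
    open cover to a countable one ([partition_of_unity]). *)

Set Implicit Arguments.
Unset Strict Implicit.
Unset Printing Implicit Defensive.

(** * Identities in modules *)

(** Identities in a module are reduced to identities in a commutative ring, which
    [ring] decides: [V] is embedded as an ideal of square zero in the ring
    [R * V], where scaling by [a] becomes multiplication by [(a, 0)]. *)
Section SquareZero.
Context {R : comNzRingType} {V : lmodType R}.

Definition sqzero : Type := (R * V)%type.
HB.instance Definition _ := GRing.Zmodule.copy sqzero (R * V)%type.

Definition sqzero_one : sqzero := (1, 0).
Definition sqzero_mul (x y : sqzero) : sqzero :=
  (x.1 * y.1, x.1 *: y.2 + y.1 *: x.2).

Fact sqzero_mulA : associative sqzero_mul.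
Proof.
move=> [a u] [b v] [c w]; congr pair => /=; first by rewrite mulrA.
by rewrite !scalerDr !scalerA addrA [c * a]mulrC [c * b]mulrC.
Qed.

Fact sqzero_mulC : commutative sqzero_mul.
Proof. by move=> [a u] [b v]; congr pair => /=; rewrite 1?mulrC 1?addrC. Qed.

Fact sqzero_mul1 : left_id sqzero_one sqzero_mul.
Proof.
by move=> [a u]; congr pair => /=; rewrite ?mul1r// scale1r scaler0 addr0.
Qed.

Fact sqzero_mulDl : left_distributive sqzero_mul +%R.
Proof.
move=> [a u] [b v] [c w]; congr pair => /=; first by rewrite mulrDl.
by rewrite scalerDl scalerDr addrACA.
Qed.

Fact sqzero_one_neq0 : sqzero_one != 0.
Proof. by apply/eqP => -[/eqP]; rewrite oner_eq0. Qed.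

HB.instance Definition _ := GRing.Zmodule_isComNzRing.Build sqzero
  sqzero_mulA sqzero_mulC sqzero_mul1 sqzero_mulDl sqzero_one_neq0.

Definition inscal (a : R) : sqzero := (a, 0).
Definition invec (u : V) : sqzero := (0, u).

Lemma invec_inj : injective invec. Proof. by move=> u v []. Qed.
Lemma invecD u v : invec (u + v) = invec u + invec v.
Proof. by congr pair; rewrite addr0. Qed.
Lemma invecN u : invec (- u) = - invec u.
Proof. by congr pair; rewrite oppr0. Qed.
Lemma invec0 : invec 0 = 0. Proof. by []. Qed.
Lemma invecZ a u : invec (a *: u) = inscal a * invec u.
Proof. by congr pair => /=; rewrite ?mulr0// scale0r addr0. Qed.

Fact inscal_zmod : zmod_morphism inscal.
Proof. by move=> a b; congr pair; rewrite /= subr0. Qed.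
Fact inscal_monoid : monoid_morphism inscal.
Proof.
by split=> // a b; congr pair; rewrite /= !scaler0 addr0.
Qed.
HB.instance Definition _ := GRing.isZmodMorphism.Build R sqzero inscal inscal_zmod.
HB.instance Definition _ := GRing.isMonoidMorphism.Build R sqzero inscal inscal_monoid.

End SquareZero.

Ltac lmod := apply: invec_inj; rewrite ?(invecD, invecN, invec0, invecZ); ring.

(** * Norming functionals *)

Lemma bounded_linear_clin {R : realType} {X Y : normedModType R} (f : X -> Y) (M : R) :
  linear f -> (forall x, `|f x| <= M * `|x|) ->
  exists T : clin X Y, T = f :> (X -> Y).
Proof.
move=> fl fM; pose pl := GRing.isLinear.Build R X Y _ f fl.
pose P : {linear X -> Y} := HB.pack f pl.
have fc : continuous f.
  apply: (@linear_bounded_continuous _ _ _ P).1; apply/linear_boundedP.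
  near=> r => x; rewrite (le_trans (fM x))// ler_wpM2r//.
have fP : f \in @clin_pred R X Y by apply/asboolP.
by exists (Clin fP).
Unshelve. all: by end_near.
Qed.

Section HahnBanach.
Context {R : realType} {Y : normedModType R}.
Implicit Types (p : Y -> R) (x y : Y).

Definition sublinear p :=
  (forall x y, p (x + y) <= p x + p y) /\
  (forall (t : R) x, 0 <= t -> p (t *: x) <= t * p x).

Lemma sublinear0 p : sublinear p -> p 0 = 0.
Proof.
move=> [pD pZ]; apply/eqP; rewrite eq_le; apply/andP; split.
  by have := pZ 0 0 (lexx _); rewrite scaler0 mul0r.
by have := pD 0 0; rewrite addr0; lra.
Qed.

Lemma sublinear_opp p x : sublinear p -> - p (- x) <= p x.
Proof.
by move=> sp; have := sp.1 x (- x); rewrite subrr (sublinear0 sp); lra.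
Qed.

Lemma sublinearZ p t x : sublinear p -> 0 <= t -> p (t *: x) = t * p x.
Proof.
move=> sp; rewrite le_eqVlt => /predU1P[<-|t0].
  by rewrite scale0r mul0r sublinear0.
apply/eqP; rewrite eq_le (sp.2 _ _ (ltW t0))/= -ler_pdivlMl//.
have /(sp.2 _ (t *: x)) : 0 <= t^-1 by rewrite invr_ge0 ltW.
by rewrite scalerA mulVf ?scale1r// gt_eqF.
Qed.

(** The expression under the infimum decreases in [t], so sliding the argument
    along [y] lowers [p]; a functional that cannot be lowered is linear. *)
Definition slide p y x := inf [set p (x + t *: y) - t * p y | t in [set t | 0 <= t]].

Lemma slide_le p y x t : sublinear p -> 0 <= t ->
  slide p y x <= p (x + t *: y) - t * p y.
Proof.
move=> sp t0; apply: ge_inf; last by exists t.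
exists (- p (- x)) => _ [s /= s0 <-].
have := sp.1 (x + s *: y) (- x).
by rewrite addrC addKr sublinearZ//; lra.
Qed.

Lemma le_slide p y x c :
  (forall t, 0 <= t -> c <= p (x + t *: y) - t * p y) -> c <= slide p y x.
Proof.
move=> h; apply: lb_le_inf; last by move=> _ [t /= t0 <-]; exact: h.
by exists (p (x + 0 *: y) - 0 * p y); exists 0 => //=.
Qed.

Lemma slide_sublinear p y : sublinear p -> sublinear (slide p y).
Proof.
move=> sp; split=> [x z|t x].
  rewrite -lerBlDr; apply: le_slide => s s0.
  rewrite lerBlDr -lerBlDl; apply: le_slide => t t0; rewrite lerBlDl.
  rewrite (le_trans (slide_le _ _ _ (addr_ge0 s0 t0)))//.
  have := sp.1 (x + s *: y) (z + t *: y).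
  by rewrite addrACA -scalerDl; lra.
rewrite le_eqVlt => /predU1P[<-|t0].
  rewrite scale0r mul0r (le_trans (slide_le y 0 sp (lexx 0)))//.
  by rewrite scale0r addr0 mul0r subr0 sublinear0.
rewrite -ler_pdivrMl//; apply: le_slide => s s0; rewrite ler_pdivrMl//.
have ts0 : 0 <= t * s by rewrite mulr_ge0// ltW.
rewrite (le_trans (slide_le y _ sp ts0))// -scalerA -scalerDr.
by rewrite (sublinearZ _ sp (ltW t0)) mulrBr mulrA.
Qed.

Lemma slide_le_self p y x : sublinear p -> slide p y x <= p x.
Proof.
move=> sp; have := slide_le y x sp (lexx 0).
by rewrite scale0r addr0 mul0r subr0.
Qed.

Lemma slide_opp p y : sublinear p -> slide p y (- y) <= - p y.
Proof.
move=> sp; have := slide_le y (- y) sp ler01.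
by rewrite scale1r addNr sublinear0// mul1r sub0r.
Qed.

(** An infimum over a chain of sublinear functionals is sublinear, so below
    every sublinear functional there is a minimal one. *)
Lemma minimal_sublinear p0 : sublinear p0 ->
  exists p, [/\ sublinear p, forall x, p x <= p0 x &
    forall q, sublinear q -> (forall x, q x <= p x) -> q = p].
Proof.
move=> sp0.
pose T := {p | sublinear p /\ forall x, p x <= p0 x}.
pose Q (p q : T) := `[< forall x, sval q x <= sval p x >].
have [|||A Atot|[p [sp pp0]] pmax] := @Zorn T Q.
- by move=> t; apply/asboolP.
- move=> r s t /asboolP rs /asboolP st; apply/asboolP => x.
  exact: le_trans (st x) (rs x).
- move=> [s ps] [t pt] /asboolP/= st /asboolP/= ts.
  have e : s = t by apply/funext => x; apply/eqP; rewrite eq_le ts st.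
  by case: _ / e in pt st ts *; congr exist; exact: Prop_irrelevance.
- have [[a Aa]|A0] := pselect (exists a, A a); last first.
    by exists (exist _ p0 (conj sp0 (fun x => lexx _))) => s As; case: A0; exists s.
  pose m x := inf [set sval a x | a in A].
  have m_le x (b : T) : A b -> m x <= sval b x.
    move=> Ab; apply: ge_inf; last by exists b.
    exists (- p0 (- x)) => _ [[c [sc cp0]] _ <-] /=.
    by rewrite (le_trans _ (sublinear_opp x sc))// lerN2.
  have le_m x c : (forall b, A b -> c <= sval b x) -> c <= m x.
    move=> h; apply: lb_le_inf; last by move=> _ [b Ab <-]; exact: h.
    by exists (sval a x), a.
  have sm : sublinear m.
    split=> [x y|t x t0].
      rewrite -lerBlDr; apply: (le_m) => b Ab.
      rewrite lerBlDr -lerBlDl; apply: (le_m) => c Ac; rewrite lerBlDl.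
      have [/asboolP bc|/asboolP cb] := Atot b c Ab Ac.
        by rewrite (le_trans (m_le _ _ Ac))// (le_trans ((svalP c).1.1 _ _))// lerD2r.
      by rewrite (le_trans (m_le _ _ Ab))// (le_trans ((svalP b).1.1 _ _))// lerD2l.
    have [->|tn0] := eqVneq t 0.
      rewrite scale0r mul0r (le_trans (m_le _ _ Aa))// sublinear0//.
      exact: (svalP a).1.
    have {tn0}t0' : 0 < t by rewrite lt_neqAle eq_sym tn0.
    rewrite -ler_pdivrMl//; apply: (le_m) => b Ab; rewrite ler_pdivrMl//.
    by rewrite (le_trans (m_le _ _ Ab))//; exact: (svalP b).1.2.
  have mp0 x : m x <= p0 x.
    by rewrite (le_trans (m_le _ _ Aa))//; exact: (svalP a).2.
  exists (exist _ m (conj sm mp0)) => s As; apply/asboolP => x /=.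
  exact: m_le.
- exists p; split=> // q sq qp.
  have qp0 x : q x <= p0 x by exact: le_trans (qp x) (pp0 x).
  have Qpq : Q (exist _ p (conj sp pp0)) (exist _ q (conj sq qp0)).
    exact/asboolP.
  by have [] := pmax _ Qpq.
Qed.

(** A minimal sublinear functional [p] is linear because sliding it along [y]
    cannot lower it, which forces [p (- y) = - p y]. Starting below the norm
    slid along [e] makes it attain [`|e|] at [e]. *)
Lemma Hahn_Banach_norming (e : Y) :
  exists phi : clin Y R^o, phi e = `|e| /\ forall x, `|phi x| <= `|x|.
Proof.
pose p1 (x : Y) := `|x|.
have sp1 : sublinear p1.
  split=> [x y|t x t0]; first exact: ler_normD.
  by rewrite /p1 normrZ ger0_norm.
have [p [sp pp1 pmin]] := minimal_sublinear (slide_sublinear e sp1).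
have pN x : p (- x) = - p x.
  have : slide p x (- x) <= - p x by exact: slide_opp.
  rewrite (pmin _ (slide_sublinear x sp) (fun z => slide_le_self x z sp)).
  by have := sublinear_opp x sp; lra.
have pD x y : p (x + y) = p x + p y.
  have := sp.1 x y; have := sp.1 (x + y) (- y); rewrite addrK pN; lra.
have pZ t x : p (t *: x) = t * p x.
  have [t0|t0] := leP 0 t; first exact: sublinearZ.
  have t0' : 0 <= - t by lra.
  by have := sublinearZ x sp t0'; rewrite scaleNr pN; lra.
have ple x : p x <= `|x| by rewrite (le_trans (pp1 x))// slide_le_self.
have pnorm x : `|p x| <= `|x|.
  by rewrite ler_norml ple andbT; have := ple (- x); rewrite normrN pN; lra.
have plin : linear (p : Y -> R^o) by move=> a u v; rewrite pD pZ.
have [|phi phiE] := bounded_linear_clin (M := 1) plin.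
  by move=> x; rewrite mul1r.
exists phi; split=> [|x]; last by rewrite phiE.
rewrite phiE; apply/eqP; rewrite eq_le ple/=.
have := slide_opp e sp1; have := pp1 (- e); rewrite pN /p1; lra.
Qed.

End HahnBanach.

(** * Mean value inequalities *)

Lemma ballE {R : realType} {X : normedModType R} (x : X) (r : R) (y : X) :
  ball x r y = (`|y - x| < r) :> Prop.
Proof. by rewrite -ball_normE /ball_ /= distrC. Qed.

Lemma sub_ball {R : realType} {X : normedModType R} (x y : X) (r s : R) :
  `|y - x| + s <= r -> ball y s `<=` ball x r.
Proof.
move=> h z; rewrite !ballE => zy; apply: lt_le_trans h.
by rewrite (le_lt_trans (ler_distD y _ _))// addrC ltrD2l.
Qed.

Section ContinuousInduction.
Context {R : realType}.

(** Along [[0, 1]] a transitive relation propagates from short to long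
    intervals: the supremum of the points related to [0] is itself related to
    [0], and would not be the supremum if it were less than [1]. *)
Lemma unit_interval_induction (Q : R -> R -> Prop) :
  (forall r s t, Q r s -> Q s t -> Q r t) ->
  (forall t : R, 0 <= t <= 1 -> exists d : R, [/\ 0 < d,
     forall s, 0 <= s -> t - d < s <= t -> Q s t &
     forall s, s <= 1 -> t <= s < t + d -> Q t s]) ->
  Q 0 1.
Proof.
move=> Qtr Qloc; pose S := [set t | 0 <= t <= 1 /\ Q 0 t].
have S0 : S 0.
  split; first by rewrite lexx ler01.
  have [|d [d0 _ +]] := Qloc 0; first by rewrite lexx ler01.
  by apply; rewrite ?ler01// lexx add0r.
have ubS : ubound S 1 by move=> t [/andP[]].
have hS : has_sup S by split; [exists 0 | exists 1].
have c0 : 0 <= sup S by apply: ub_le_sup S0; exists 1.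
have c1 : sup S <= 1 by apply: ge_sup => //; exists 0.
have [|d [d0 Ql Qr]] := Qloc (sup S); first by rewrite c0.
have [s [/andP[s0 s1] Q0s] ds] := sup_adherent d0 hS.
have ssup : s <= sup S.
  by apply: ub_le_sup; [exists 1 | split=> //; rewrite s0].
have Q0c : Q 0 (sup S) by apply: (Qtr _ s) => //; apply: Ql => //; rewrite ds.
move: c1; rewrite le_eqVlt => /predU1P[<-//|c1].
pose t := Num.min 1 (sup S + d / 2).
have [t1 tc] : t <= 1 /\ sup S < t by split; rewrite /t ?ge_min ?lexx// lt_min c1/=; lra.
have td : t < sup S + d by rewrite /t gt_min; apply/orP; right; lra.
have : S t.
  split; first by rewrite t1 andbT; lra.
  by apply: Qtr Q0c _; apply: Qr => //; rewrite td andbT ltW.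
move=> St; have : t <= sup S by apply: ub_le_sup St; exists 1.
by lra.
Qed.

End ContinuousInduction.

Section MeanValue.
Context {R : realType} {X Y : normedModType R}.
Implicit Types (h : X -> Y) (L : R).

Definition lip L (A : set X) h :=
  forall y z, A y -> A z -> `|h y - h z| <= L * `|y - z|.

(** The point [z] is fixed, so that differentiability at [z] suffices for it. *)
Definition lip_at L h (z : X) :=
  exists2 d : R, 0 < d & forall w, ball z d w -> `|h w - h z| <= L * `|w - z|.

(** Chaining the estimates at the points of the segment gives the mean value
    inequality without integrals or functionals. *)
Lemma lip_at_segment L h (x y : X) :
  (forall t : R, 0 <= t <= 1 -> lip_at L h (x + t *: (y - x))) ->
  `|h y - h x| <= L * `|y - x|.
Proof.
move=> hloc; pose g t := x + t *: (y - x).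
have gB s t : g s - g t = (s - t) *: (y - x).
  by rewrite /g; lmod.
have nxy : 0 < `|y - x| + 1 by rewrite ltr_wpDl.
have := @unit_interval_induction R
  (fun s t => `|h (g t) - h (g s)| <= L * `|y - x| * (t - s)).
rewrite /g scale1r subrKC scale0r addr0 subr0 mulr1; apply.
  move=> r s t rs st; rewrite (le_trans (ler_distD (h (g s)) _ _))//.
  by rewrite (le_trans (lerD st rs))// le_eqVlt; apply/orP; left; apply/eqP; ring.
move=> t t01; have [d d0 hd] := hloc t t01.
have near s : `|s - t| < d / (`|y - x| + 1) -> ball (g t) d (g s).
  rewrite ballE gB normrZ ltr_pdivlMr// => /(le_lt_trans _); apply.
  by rewrite ler_wpM2l// lerDl.
exists (d / (`|y - x| + 1)); split; first exact: divr_gt0.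
  move=> s s0 /andP[ds st]; rewrite distrC (le_trans (hd _ _))//.
    by apply: near; rewrite distrC ger0_norm; lra.
  by rewrite gB normrZ distrC ger0_norm ?subr_ge0// mulrCA mulrC.
move=> s s1 /andP[ts sd]; rewrite (le_trans (hd _ _))//.
  by apply: near; rewrite ger0_norm; lra.
by rewrite gB normrZ ger0_norm ?subr_ge0// mulrCA mulrC.
Qed.

Lemma lip_at_convex L h (A : set X) :
  (forall x y (t : R), A x -> A y -> 0 <= t <= 1 -> A (x + t *: (y - x))) ->
  (forall z, A z -> lip_at L h z) -> lip L A h.
Proof.
move=> Acvx hA y z Ay Az; apply: lip_at_segment => t t01; apply: hA.
exact: Acvx.
Qed.

Lemma lip_at_ball L h (a : X) (r : R) :
  (forall z, ball a r z -> lip_at L h z) -> lip L (ball a r) h.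
Proof.
apply: lip_at_convex => x y t; rewrite !ballE => xa ya /andP[t0 t1].
have -> : x + t *: (y - x) - a = (1 - t) *: (x - a) + t *: (y - a).
  by lmod.
rewrite (le_lt_trans (ler_normD _ _))// !normrZ !ger0_norm ?subr_ge0//.
have [t_half|t_half] := ltP t (1 / 2).
  have : t * `|y - a| <= t * r by rewrite ler_wpM2l// ltW.
  have : (1 - t) * `|x - a| < (1 - t) * r by rewrite ltr_pM2l//; lra.
  by lra.
have : t * `|y - a| < t * r by rewrite ltr_pM2l//; lra.
have : (1 - t) * `|x - a| <= (1 - t) * r by rewrite ler_wpM2l ?subr_ge0// ltW.
by lra.
Qed.

End MeanValue.

Section MeanValueCurve.
Context {R : realType} {X Y : normedModType R}.

Fixpoint polygon_length (gamma : R -> X) (a : R) (s : seq R) : R :=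
  if s is b :: s' then `|gamma b - gamma a| + polygon_length gamma b s' else 0.

Lemma polygon_lengthE gamma a s :
  \sum_(i < size s) `|gamma (nth 0 (a :: s) i.+1) - gamma (nth 0 (a :: s) i)|
  = polygon_length gamma a s.
Proof.
elim: s a => [|b s ih] a /=; first by rewrite big_ord0.
by rewrite big_ord_recl /= -(ih b).
Qed.

Lemma polygon_length_cat gamma a s t :
  polygon_length gamma a (s ++ t) =
  polygon_length gamma a s + polygon_length gamma (last a s) t.
Proof. by elim: s a => [|b s ih] a /=; rewrite ?add0r// ih addrA. Qed.

(** Each point of the curve has a neighbourhood in which [h] satisfies the
    estimate; chaining these neighbourhoods produces a partition of [[0, 1]]
    along which [h] grows at most [L] times as fast as the inscribed polygon. *)
Lemma lip_at_curve (L : R) (h : X -> Y) (gamma : R -> X) (l : R) :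
  0 <= L -> {within `[0, 1], continuous gamma} ->
  (curve_length gamma <= l%:E)%E ->
  (forall t : R, 0 <= t <= 1 -> lip_at L h (gamma t)) ->
  `|h (gamma 1) - h (gamma 0)| <= L * l.
Proof.
move=> L0 gc gl hloc.
suff [s [ps /eqP ls]] : exists s, [/\ path <%R 0 s, last 0 s = 1 &
    `|h (gamma 1) - h (gamma 0)| <= L * polygon_length gamma 0 s].
  move=> /le_trans; apply; rewrite ler_wpM2l// -lee_fin (le_trans _ gl)//.
  by apply: ereal_sup_ubound; exists s => //=; rewrite polygon_lengthE.
apply: (@unit_interval_induction R (fun a b => exists s, [/\ path <%R a s,
  last a s = b &
  `|h (gamma b) - h (gamma a)| <= L * polygon_length gamma a s])).
  move=> a b c [s [ps ls hs]] [t [pt lt ht]]; exists (s ++ t); split.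
  - by rewrite cat_path ps ls.
  - by rewrite last_cat ls.
  rewrite (le_trans (ler_distD (h (gamma b)) _ _))// polygon_length_cat ls.
  by rewrite mulrDr addrC lerD.
have step a b : a <= b ->
    `|h (gamma b) - h (gamma a)| <= L * `|gamma b - gamma a| ->
    exists s, [/\ path <%R a s, last a s = b &
      `|h (gamma b) - h (gamma a)| <= L * polygon_length gamma a s].
  rewrite le_eqVlt => /predU1P[<- _|ab hab].
    by exists [::]; split=> //=; rewrite subrr normr0 mulr0.
  by exists [:: b]; split=> //=; rewrite ?ab ?addr0.
move=> t t01; have [d d0 hd] := hloc t t01.
have /subspace_continuousP/(_ t) := gc.
have It (u : R) : 0 <= u <= 1 -> `[0, 1]%classic u by rewrite /= in_itv.
move=> /(_ (It _ t01)) /cvgrPdist_lt/(_ _ d0).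
rewrite near_withinE => /nbhs_ballP[e /= e0 he].
have near s : 0 <= s <= 1 -> `|s - t| < e -> ball (gamma t) d (gamma s).
  move=> s01 st; rewrite ballE distrC; apply: he; last exact: It.
  by rewrite /ball/= distrC.
move/andP: t01 => [t0 t1].
exists e; split=> // s.
  move=> s0 /andP[es st]; apply: step => //; rewrite distrC [`|gamma _ - _|]distrC.
  by apply: hd; apply: near; [lra | rewrite distrC ger0_norm; lra].
move=> s1 /andP[ts se]; apply: step => //.
by apply: hd; apply: near; [lra | rewrite ger0_norm; lra].
Qed.

End MeanValueCurve.

(** * Strict differentiability *)

Section ClinBasics.
Context {R : realType} {X Y : normedModType R}.
Implicit Types (S T : clin X Y).

Lemma clinD S T x : (S + T) x = S x + T x. Proof. by []. Qed.
Lemma clinB S T x : (S - T) x = S x - T x. Proof. by []. Qed.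
Lemma clin0 x : (0 : clin X Y) x = 0. Proof. by []. Qed.

Lemma clin_norm T x : `|T x| <= `|T| * `|x|. Proof. exact: opnorm_ub. Qed.

Lemma clin_norm_le T (c : R) : (forall x, `|T x| <= c * `|x|) -> 0 <= c ->
  `|T| <= c.
Proof.
move=> Tc c0; apply: opnorm_le => x x1; rewrite (le_trans (Tc x))//.
by rewrite ler_piMr.
Qed.

End ClinBasics.

Section Lip.
Context {R : realType} {X Y : normedModType R}.
Implicit Types (f g : X -> Y) (T : clin X Y).

Lemma lip_sub (L : R) (A B : set X) f : A `<=` B -> lip L B f -> lip L A f.
Proof. by move=> AB fB y z Ay Az; apply: fB; exact: AB. Qed.

Lemma lipW (L M : R) (A : set X) f : L <= M -> lip L A f -> lip M A f.
Proof.
by move=> LM fA y z Ay Az; rewrite (le_trans (fA _ _ Ay Az))// ler_wpM2r.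
Qed.

Lemma lip_ext (L : R) (A : set X) f g :
  (forall x, A x -> f x = g x) -> lip L A f -> lip L A g.
Proof. by move=> fg fA y z Ay Az; rewrite -!fg//; exact: fA. Qed.

Lemma lipD (L M : R) (A : set X) f g :
  lip L A f -> lip M A g -> lip (L + M) A (fun x => f x + g x).
Proof.
move=> fA gA y z Ay Az.
have -> : f y + g y - (f z + g z) = (f y - f z) + (g y - g z) by lmod.
by rewrite (le_trans (ler_normD _ _))// mulrDl lerD ?fA ?gA.
Qed.

Lemma lipN (L : R) (A : set X) f : lip L A f -> lip L A (fun x => - f x).
Proof. by move=> fA y z Ay Az; rewrite -opprD normrN; exact: fA. Qed.

Lemma lipB (L M : R) (A : set X) f g :
  lip L A f -> lip M A g -> lip (L + M) A (fun x => f x - g x).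
Proof. by move=> fA gA; apply: lipD => //; exact: lipN. Qed.

Lemma lip_clin T (A : set X) : lip `|T| A T.
Proof. by move=> y z _ _; rewrite -linearB; exact: clin_norm. Qed.

(** By homogeneity any ball, however small, sees the whole linear map. *)
Lemma lip_ball_clin (L : R) (x : X) (r : R) T :
  0 < r -> 0 <= L -> lip L (ball x r) T -> `|T| <= L.
Proof.
move=> r0 L0 TL; apply: clin_norm_le => // u.
have nu : 0 < `|u| + 1 by rewrite ltr_wpDl.
pose s := r / (`|u| + 1).
have s0 : 0 < s by exact: divr_gt0.
have su : `|s *: u| < r.
  by rewrite normrZ gtr0_norm// mulrAC ltr_pdivrMr// ltr_pM2l// ltrDl.
have E : x + s *: u - x = s *: u by lmod.
have := TL (x + s *: u) x; rewrite !ballE subrr normr0 E.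
move=> /(_ su r0).
by clearbody s; rewrite -linearB E linearZ/= !normrZ gtr0_norm// mulrCA ler_pM2l//.
Qed.

End Lip.

Section StrictDerivative.
Context {R : realType}.

(** Strict differentiability: unlike the Fréchet derivative it is stated by
    Lipschitz constants alone, and holding at all points of an open set it
    amounts to continuous differentiability there. *)
Definition sderiv {X Y : normedModType R} (f : X -> Y) (x : X) (T : clin X Y) :=
  forall e : R, 0 < e -> exists2 d : R, 0 < d &
    lip e (ball x d) (fun y => f y - T y).

Definition sdiff {X Y : normedModType R} (f : X -> Y) (x : X) :=
  exists T, sderiv f x T.

Section Basics.
Context {X Y : normedModType R}.
Implicit Types (f g : X -> Y) (T : clin X Y).

Lemma sderiv_ext f g x T (d : R) : 0 < d -> (forall y, ball x d y -> f y = g y) ->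
  sderiv f x T -> sderiv g x T.
Proof.
move=> d0 fg fT e /fT[d' d'0 h]; exists (Num.min d d'); first by rewrite lt_min d0.
apply: lip_ext (lip_sub _ h); last by apply: le_ball; rewrite ge_min lexx orbT.
by move=> y ym; rewrite fg//; apply: le_ball ym; rewrite ge_min lexx.
Qed.

Lemma sdiff_ext f g x (d : R) : 0 < d -> (forall y, ball x d y -> f y = g y) ->
  sdiff f x -> sdiff g x.
Proof. by move=> d0 fg [T fT]; exists T; exact: sderiv_ext d0 fg fT. Qed.

Lemma sderiv_lip f x T : sderiv f x T -> exists2 d : R, 0 < d &
  lip (`|T| + 1) (ball x d) f.
Proof.
move=> /(_ 1 ltr01)[d d0 h]; exists d => //.
apply: lip_ext (lipD (lip_clin T (A:=_)) h) => y _.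
by rewrite subrKC.
Qed.

Lemma sderiv_near f x T (e : R) : sderiv f x T -> 0 < e ->
  exists2 d : R, 0 < d & forall y, ball x d y -> `|f y - f x| <= e.
Proof.
move=> /sderiv_lip[d d0 h] e0.
have T0 : 0 < `|T| + 1 by rewrite ltr_wpDl.
exists (Num.min d (e / (`|T| + 1))); first by rewrite lt_min d0 divr_gt0.
move=> y; rewrite ballE lt_min => /andP[yd ye].
rewrite (le_trans (h _ _ _ _)) ?ballE ?subrr ?normr0//.
by rewrite mulrC -ler_pdivlMr// ltW.
Qed.

Lemma sderivD f g x S T : sderiv f x S -> sderiv g x T ->
  sderiv (fun y => f y + g y) x (S + T).
Proof.
move=> fS gT e e0; have e20 : 0 < e / 2 by rewrite divr_gt0.
have [d d0 hd] := fS _ e20; have [d' d'0 hd'] := gT _ e20.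
exists (Num.min d d'); first by rewrite lt_min d0.
apply: (lip_ext (f := fun y => (f y - S y) + (g y - T y))).
  by move=> y _; rewrite clinD; lmod.
rewrite [e]splitr; apply: lipD.
  by apply: lip_sub hd; apply: le_ball; rewrite ge_min lexx.
by apply: lip_sub hd'; apply: le_ball; rewrite ge_min lexx orbT.
Qed.

Lemma sderiv_clin T x : sderiv T x T.
Proof. by move=> e e0; exists 1 => // y z _ _; rewrite !subrr normr0 mulr_ge0// ltW. Qed.

Lemma sderiv_cst (c : Y) (x : X) : sderiv (fun=> c) x 0.
Proof. by move=> e e0; exists 1 => // y z _ _; rewrite !clin0 subrr normr0 mulr_ge0// ltW. Qed.

Lemma sdiffD f g x : sdiff f x -> sdiff g x -> sdiff (fun y => f y + g y) x.
Proof. by move=> [S fS] [T gT]; exists (S + T); exact: sderivD. Qed.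

Lemma sdiff_cst (c : Y) (x : X) : sdiff (fun=> c) x.
Proof. by exists 0; exact: sderiv_cst. Qed.

Lemma sdiff_clin T x : sdiff T x. Proof. by exists T; exact: sderiv_clin. Qed.

Lemma sdiff_sum (n : nat) (h : nat -> X -> Y) x :
  (forall k, (k < n)%N -> sdiff (h k) x) ->
  sdiff (fun y => \sum_(k < n) h k y) x.
Proof.
elim: n => [|n ih] hn.
  apply: (sdiff_ext (f := fun=> 0) ltr01); last exact: sdiff_cst.
  by move=> y _; rewrite big_ord0.
apply: (sdiff_ext (f := fun y => \sum_(k < n) h k y + h n y) ltr01).
  by move=> y _; rewrite big_ord_recr.
by apply: sdiffD; [apply: ih => k kn; apply: hn; exact: ltnW | exact: hn].
Qed.

End Basics.

Lemma sdiffZ {X Y : normedModType R} (psi : X -> R^o) (f : X -> Y) (x : X) :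
  sdiff psi x -> sdiff f x -> sdiff (fun y => (psi y : R) *: f y) x.
Proof.
move=> [S pS] [T fT].
have [||D DE] := @bounded_linear_clin R X Y
    (fun u => (psi x : R) *: T u + (S u : R) *: f x)
    (`|psi x| * `|T| + `|S| * `|f x|).
- move=> a u v.
  have -> : S (a *: u + v) = a * S u + S v :> R by exact: linearP.
  have -> : T (a *: u + v) = a *: T u + T v by exact: linearP.
  by lmod.
- move=> u; rewrite (le_trans (ler_normD _ _))// !normrZ mulrDl -mulrA.
  by rewrite lerD ?ler_wpM2l ?clin_norm// mulrAC ler_wpM2r// clin_norm.
exists D => e e0.
pose K := `|psi x| + 1 + `|T| + (`|f x| + 1) + `|S|.
have K0 : 0 < K.
  by rewrite /K -!addrA ltr_wpDl// ltr_pwDl// !addr_ge0.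
(* [K] collects the factors of the error terms; adding [e] keeps [eta <= 1]. *)
pose eta := e / (K + e).
have eta0 : 0 < eta by rewrite divr_gt0// addr_gt0.
have Ke : 0 < K + e by exact: addr_gt0.
have eta1 : eta <= 1 by rewrite /eta ler_pdivrMr// mul1r lerDr ltW.
have etaK : eta * K <= e.
  by rewrite /eta mulrAC ler_pdivrMr// ler_pM2l// lerDl ltW.
clearbody eta.
have [d1 d10 h1] := pS _ eta0; have [d2 d20 h2] := fT _ eta0.
have [d3 d30 h3] := sderiv_near pS eta0; have [d4 d40 h4] := sderiv_near fT eta0.
pose d := Num.min (Num.min d1 d2) (Num.min d3 d4).
have [dd1 dd2 dd3 dd4] : [/\ d <= d1, d <= d2, d <= d3 & d <= d4].
  by rewrite /d !ge_min !lexx ?orbT.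
exists d; first by rewrite !lt_min d10 d20 d30 d40.
move=> y z By Bz.
have -> : (psi y : R) *: f y - D y - ((psi z : R) *: f z - D z) =
  ((psi y : R) *: ((f y - T y) - (f z - T z)) + ((psi y : R) - psi x) *: T (y - z)) +
  (((psi y - S y) - (psi z - S z) : R) *: f z + (S (y - z) : R) *: (f z - f x)).
  by rewrite !DE !linearB/=; lmod.
have e1 : `|psi y - psi x| <= eta by apply: h3; exact: le_ball By.
have e2 : `|psi y| <= `|psi x| + 1.
  rewrite -[psi y](subrK (psi x)) (le_trans (ler_normD _ _))// addrC lerD2l.
  exact: le_trans e1 eta1.
have e3 : `|f z - f x| <= eta by apply: h4; exact: le_ball Bz.
have e4 : `|f z| <= `|f x| + 1.
  rewrite -[f z](subrK (f x)) (le_trans (ler_normD _ _))// addrC lerD2l.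
  exact: le_trans e3 eta1.
have e5 : `|(f y - T y) - (f z - T z)| <= eta * `|y - z|.
  by apply: h2; [exact: le_ball By | exact: le_ball Bz].
have e6 : `|(psi y - S y) - (psi z - S z)| <= eta * `|y - z|.
  by apply: h1; [exact: le_ball By | exact: le_ball Bz].
apply: (@le_trans _ _ (eta * K * `|y - z|)); last by rewrite ler_wpM2r.
apply: (@le_trans _ _ (((`|psi x| + 1) * (eta * `|y - z|) + eta * (`|T| * `|y - z|)) +
  ((eta * `|y - z|) * (`|f x| + 1) + (`|S| * `|y - z|) * eta))); last first.
  by rewrite le_eqVlt; apply/orP; left; apply/eqP; rewrite /K; ring.
do ![apply: (le_trans (ler_normD _ _)); apply: lerD]; rewrite normrZ ler_pM//.
- exact: clin_norm.
- exact: clin_norm.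
Qed.

Lemma sdiff_comp {X Y Z : normedModType R} (f : X -> Y) (h : Y -> Z) (x : X) :
  sdiff f x -> sdiff h (f x) -> sdiff (h \o f) x.
Proof.
move=> [T fT] [S hS].
have [||D DE] := @bounded_linear_clin R X Z (S \o T) (`|S| * `|T|).
- by move=> a u v /=; rewrite !linearP.
- by move=> u; rewrite (le_trans (clin_norm _ _))// -mulrA ler_wpM2l ?clin_norm.
exists D => e e0.
pose K := `|T| + 1 + `|S|.
have K0 : 0 < K by rewrite /K -addrA ltr_wpDl// ltr_pwDl.
have eta0 : 0 < e / K by exact: divr_gt0.
have [d1 d10 h1] := fT _ eta0; have [d2 d20 h2] := hS _ eta0.
have [d3 d30 h3] := sderiv_lip fT.
have d220 : 0 < d2 / 2 by exact: divr_gt0.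
have [d4 d40 h4] := sderiv_near fT d220.
pose d := Num.min d1 (Num.min d3 d4).
have [dd1 dd3 dd4] : [/\ d <= d1, d <= d3 & d <= d4].
  by rewrite /d !ge_min !lexx ?orbT.
exists d; first by rewrite !lt_min d10 d30 d40.
move=> y z By Bz /=; rewrite !DE /=.
have -> : h (f y) - S (T y) - (h (f z) - S (T z)) =
  ((h (f y) - S (f y)) - (h (f z) - S (f z))) +
  S ((f y - T y) - (f z - T z)) by rewrite !linearB/=; lmod.
have fB w : ball x d w -> ball (f x) d2 (f w).
  move=> Bw; rewrite ballE (le_lt_trans (h4 _ (le_ball dd4 Bw)))//.
  by rewrite ltr_pdivrMr// ltr_pMr// ltr1n.
rewrite (le_trans (ler_normD _ _))//.
have e1 : `|f y - f z| <= (`|T| + 1) * `|y - z|.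
  by apply: h3; [exact: le_ball By | exact: le_ball Bz].
have e2 : `|h (f y) - S (f y) - (h (f z) - S (f z))| <=
    e / K * ((`|T| + 1) * `|y - z|).
  rewrite (le_trans (h2 _ _ (fB _ By) (fB _ Bz)))// ler_wpM2l//.
  by rewrite ltW.
have e3 : `|S (f y - T y - (f z - T z))| <= `|S| * (e / K * `|y - z|).
  rewrite (le_trans (clin_norm _ _))// ler_wpM2l//.
  by apply: h1; [exact: le_ball By | exact: le_ball Bz].
rewrite (le_trans (lerD e2 e3))// le_eqVlt; apply/orP; left; apply/eqP.
transitivity (e / K * K * `|y - z|); first by rewrite [in RHS]/K; ring.
by rewrite divfK// gt_eqF.
Qed.

End StrictDerivative.

(** * Continuous and strict differentiability *)

Lemma open_ball {R : realType} {X : normedModType R} (U : set X) (x : X) :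
  open U -> U x -> exists2 r : R, 0 < r & ball x r `<=` U.
Proof.
by move=> oU Ux; have /nbhs_ballP[r /= r0 rU] := open_nbhs_nbhs (conj oU Ux); exists r.
Qed.

Lemma curve_length_ge {R : realType} {X : normedModType R} (gamma : R -> X)
    (l t : R) :
  (curve_length gamma <= l%:E)%E -> 0 <= t <= 1 -> `|gamma t - gamma 0| <= l.
Proof.
move=> gl /andP[t0 t1].
have part s : itv_partition 0 1 s -> polygon_length gamma 0 s <= l.
  move=> s01; rewrite -lee_fin (le_trans _ gl)//.
  by apply: ereal_sup_ubound; exists s => //=; rewrite polygon_lengthE.
have p1 : `|gamma 1 - gamma 0| <= l.
  by have := part [:: 1]; rewrite /= addr0; apply; split=> //=; rewrite ltr01.
move: t0; rewrite le_eqVlt => /predU1P[<-|t0].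
  by rewrite subrr normr0 (le_trans _ p1).
move: t1; rewrite le_eqVlt => /predU1P[->//|t1].
have := part [:: t; 1]; rewrite /= addr0 => h.
have : `|gamma t - gamma 0| + `|gamma 1 - gamma t| <= l.
  by apply: h; split=> //=; rewrite t0 t1.
by apply: le_trans; rewrite lerDl.
Qed.

Section C1Strict.
Context {R : realType} {X Y : normedModType R}.
Implicit Types (f : X -> Y) (T : clin X Y).

Lemma differentiable_frechet f (z : X) (e : R) : differentiable f z -> 0 < e ->
  exists2 d : R, 0 < d & forall w, ball z d w ->
    `|f w - f z - frechet f z (w - z)| <= e * `|w - z|.
Proof.
move=> fz e0; have /eqaddoP/(_ _ e0)/nbhs_ballP[d /= d0 hd] := diff_locally fz.
exists d => // w; rewrite ballE => wz; have := hd (w - z).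
rewrite -ball_normE /ball_/= sub0r normrN => /(_ wz).
by rewrite !fctE/= subrK frechetE// opprD addrA.
Qed.

(** The mean value inequality, applied to [f] minus its derivative at [x]. *)
Lemma Ck1_sderiv f (U : set X) (x : X) : open U -> Ck (Some 1%N) U f -> U x ->
  sderiv f x (frechet f x).
Proof.
move=> oU [fd fc] Ux e e0; have e20 : 0 < e / 2 by rewrite divr_gt0.
have [r r0 rU] := open_ball oU Ux.
have /subspace_continuousP/(_ x Ux)/cvgrPdist_lt/(_ _ e20) := fc.
rewrite near_withinE => /nbhs_ballP[d /= d0 hd].
exists (Num.min r d); first by rewrite lt_min r0.
apply: lip_at_ball => z Bz.
have Uz : U z by apply: rU; apply: le_ball Bz; rewrite ge_min lexx.
have hz : `|frechet f x - frechet f z| < e / 2.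
  by apply: hd => //; apply: le_ball Bz; rewrite ge_min lexx orbT.
have [s s0 hs] := differentiable_frechet (fd z Uz) e20.
exists s => // w Bw.
have -> : f w - frechet f x w - (f z - frechet f x z) =
    (f w - f z - frechet f z (w - z)) - (frechet f x - frechet f z) (w - z).
  by rewrite clinB !linearB; lmod.
rewrite (le_trans (ler_normB _ _))// [e in leRHS]splitr mulrDl lerD ?hs//.
by rewrite (le_trans (clin_norm _ _))// ler_wpM2r// ltW.
Qed.

Lemma sderiv_frechet f (x : X) T : sderiv f x T ->
  differentiable f x /\ frechet f x = T.
Proof.
move=> fT.
have fo : f \o shift x = cst (f x) + T +o_ 0 id.
  apply/eqaddoP => e e0; have [d d0 hd] := fT e e0.
  apply/nbhs_ballP; exists d => // h; rewrite ballE subr0 => hh.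
  rewrite !fctE/= opprD addrA.
  have := hd (h + x) x; rewrite !ballE addrK subrr normr0 => /(_ hh d0).
  by rewrite linearD/=; congr (`|_| <= _); lmod.
have dE : 'd f x = T :> (X -> Y) by apply: diff_unique fo; exact: clin_continuous.
have fd : differentiable f x.
  by apply/diff_locallyP; rewrite dE; split=> //; exact: clin_continuous.
by split=> //; apply/val_inj; rewrite /= frechetE.
Qed.

(** A strict derivative [T] at [x] controls [f] at all pairs of points near [x],
    hence also the derivatives at the points near [x]; this is their continuity. *)
Lemma sdiff_Ck1 f (U : set X) : open U -> (forall x, U x -> sdiff f x) ->
  Ck (Some 1%N) U f.
Proof.
move=> oU fU; have fT x : U x -> sderiv f x (frechet f x).
  by move=> /fU[T fT]; have [_ ->] := sderiv_frechet fT.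
split=> [x /fU[T /sderiv_frechet[]]//|].
apply/subspace_continuousP => x Ux; apply/cvgrPdist_le => e e0.
rewrite near_withinE; have e20 : 0 < e / 2 by rewrite divr_gt0.
have [d d0 hd] := fT x Ux _ e20.
apply/nbhs_ballP; exists d => // y By Uy.
have [d' d'0 hd'] := fT y Uy _ e20.
have [s s0 sB] := open_ball (ball_open x d) By.
apply: (@lip_ball_clin _ _ _ _ y (Num.min s d')); rewrite ?lt_min ?s0 ?ltW//.
apply: (lip_ext (f := fun z => (f z - frechet f y z) - (f z - frechet f x z))).
  by move=> z _; rewrite clinB; lmod.
rewrite [e]splitr; apply: lipB.
  by apply: lip_sub hd'; apply: le_ball; rewrite ge_min lexx orbT.
apply: lip_sub hd; apply: subset_trans sB.
by apply: le_ball; rewrite ge_min lexx.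
Qed.

End C1Strict.

(** * The Whitney condition on the closure *)

Section Whitney.
Context {R : realType} {X : normedModType R} {Y : completeNormedModType R}.

(** The Whitney condition on [A]: the increments of [f] within [A] are governed
    by [G] as those of a strictly differentiable function by its derivative. *)
Definition whitney (A : set X) (f : X -> Y) (G : X -> clin X Y) :=
  forall a, A a -> forall e : R, 0 < e -> exists2 d : R, 0 < d &
    lip e (A `&` ball a d) (fun y => f y - G a y).

Definition cont_on (A : set X) (G : X -> clin X Y) :=
  forall a, A a -> forall e : R, 0 < e -> exists2 d : R, 0 < d &
    forall y, A y -> ball a d y -> `|G y - G a| <= e.

Lemma cont_onE (A : set X) (G : X -> clin X Y) :
  {within A, continuous G} -> cont_on A G.
Proof.
move=> Gc a Aa e e0; have /subspace_continuousP/(_ a Aa)/cvgrPdist_le/(_ _ e0) := Gc.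
rewrite near_withinE => /nbhs_ballP[d /= d0 hd]; exists d => // y Ay By.
by rewrite distrC; exact: hd.
Qed.

Variables (U : set X) (f : X -> Y) (G : X -> clin X Y).
Hypotheses (oU : open U) (wqU : WQ U) (fC1 : Ck (Some 1%N) U f).
Hypotheses (GU : forall x, U x -> G x = frechet f x) (Gc : cont_on (closure U) G).

(** Near a boundary point [a] two points of [U] are joined inside [U] by a curve
    of comparable length; such a curve stays near [a], where the derivative of
    [f - G a] is small. *)
Lemma whitney_interior a : closure U a -> forall e : R, 0 < e ->
  exists2 d : R, 0 < d & lip e (U `&` ball a d) (fun y => f y - G a y).
Proof.
move=> Ua e e0; have [Uia|Ua'] := pselect (U a).
  have [d d0 hd] := Ck1_sderiv oU fC1 Uia e0; exists d => //.
  by rewrite GU//; apply: lip_sub hd.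
have [|r [c [r0 c1 hc]]] := wqU (a := a).
  by split=> // /interior_subset.
have c0 : 0 < c by exact: lt_le_trans c1.
have ec0 : 0 < e / c / 2 by rewrite !divr_gt0.
have [s s0 hs] := Gc Ua ec0.
(* Two points of [ball a d] are joined by a curve of length at most [2 * c * d],
   which therefore stays in [ball a ((1 + 2 * c) * d)]. *)
pose d := Num.min r (s / (1 + 2 * c)).
have c2_gt0 : 0 < 1 + 2 * c by lra.
have d0 : 0 < d by rewrite lt_min r0 divr_gt0.
have [dr ds] : d <= r /\ d * (1 + 2 * c) <= s.
  by rewrite -ler_pdivlMr// /d !ge_min !lexx orbT.
clearbody d.
exists d => // y z [Uy By] [Uz Bz].
have [||g [gc gU [g0 g1] _ gl]] := hc y z.
- by split=> //; exact: le_ball By.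
- by split=> //; exact: le_ball Bz.
have yz : `|y - z| < 2 * d.
  move: By Bz; rewrite !ballE => By Bz.
  by have := ler_distD a y z; rewrite (distrC a z); lra.
have loc (t : R) : 0 <= t <= 1 -> lip_at (e / c) (fun y => f y - G a y) (g t).
  move=> t01; have Ugt : U (g t) by apply: gU; rewrite /= in_itv.
  have gta : ball a s (g t).
    have := curve_length_ge gl t01; rewrite g0 => gty.
    have : c * `|y - z| <= c * (2 * d) by rewrite ler_pM2l// ltW.
    move: By; rewrite !ballE => By.
    have cd : 0 < c * d by exact: mulr_gt0.
    by have := ler_distD y (g t) a; move: ds; rewrite mulrDr; lra.
  have [d' d'0 hd'] := Ck1_sderiv oU fC1 Ugt ec0.
  exists d' => // w Bw.
  have -> : f w - G a w - (f (g t) - G a (g t)) =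
     (f w - frechet f (g t) w - (f (g t) - frechet f (g t) (g t))) +
     (frechet f (g t) - G a) (w - g t).
    by rewrite clinB !linearB; lmod.
  rewrite (le_trans (ler_normD _ _))// [e / c in leRHS]splitr mulrDl lerD//.
    by apply: hd' => //; rewrite ballE subrr normr0.
  rewrite (le_trans (clin_norm _ _))// ler_wpM2r// -GU//.
  by apply: hs => //; exact: subset_closure.
have ec0' : 0 <= e / c by rewrite divr_ge0// ltW.
have := lip_at_curve ec0' gc gl loc.
by rewrite g0 g1 distrC mulrA divfK// gt_eqF.
Qed.

(** By completeness of [Y], the local Lipschitz bound of the Whitney condition
    gives [f] a limit at each boundary point. *)
Lemma limit_at_closure a : closure U a -> exists v : Y, forall e : R, 0 < e ->
  exists2 d : R, 0 < d & forall y, U y -> ball a d y -> `|f y - v| <= e.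
Proof.
move=> Ua; have [d d0 hd] := whitney_interior Ua ltr01.
have fl : lip (1 + `|G a|) (U `&` ball a d) f.
  apply: lip_ext (lipD hd (lip_clin (G a) (A:=_))) => y _ /=.
  by rewrite subrK.
have G0 : 0 < 1 + `|G a| by rewrite ltr_pwDl.
pose F := within U (nbhs a).
have PF : ProperFilter F by exact: within_nbhs_proper.
have cF : cauchy (f @ F).
  apply: cauchy_exP => e e0.
  pose s := Num.min d (e / (1 + `|G a|) / 2).
  have s0 : 0 < s by rewrite lt_min d0 !divr_gt0.
  have [y [Uy By]] := Ua _ (nbhsx_ballx a s s0).
  exists (f y); apply/nbhs_ballP; exists s => // z Bz Uz; rewrite /= ballE.
  have [By' Bz'] : ball a d y /\ ball a d z.
    by split; [apply: le_ball By | apply: le_ball Bz]; rewrite ge_min lexx.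
  rewrite (le_lt_trans (fl _ _ _ _))//.
  have : `|z - y| < e / (1 + `|G a|).
    have es : s <= e / (1 + `|G a|) / 2.
      by rewrite /s ge_min lexx orbT.
    move: By Bz; rewrite !ballE => By Bz.
    by have := ler_distD a z y; rewrite (distrC a y); lra.
  by rewrite ltr_pdivlMr// mulrC.
have [v fv] := (cvg_ex _).1 (cauchy_cvg _ cF).
exists v => e e0; move: fv => /cvgrPdist_le/(_ _ e0).
rewrite near_withinE => /nbhs_ballP[s s0 hs]; exists s => // y Uy By.
by rewrite distrC; exact: hs.
Qed.

(** The estimates between points of [U] pass to the limit at the points of the
    closure. *)
Lemma whitney_closure : exists fb : X -> Y,
  (forall x, U x -> fb x = f x) /\ whitney (closure U) fb G.
Proof.
have /choice[fb hfb] : forall a, exists v : Y, closure U a -> forall e : R, 0 < e ->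
    exists2 d : R, 0 < d & forall y, U y -> ball a d y -> `|f y - v| <= e.
  move=> a; have [/limit_at_closure[v hv]|na] := pselect (closure U a).
    by exists v.
  by exists 0.
exists fb; split=> [x Ux|a Ua e e0].
  apply/eqP; rewrite -subr_eq0 -normr_le0; apply/ler_addgt0Pl => e e0.
  rewrite addr0 distrC; have [d d0] := hfb x (subset_closure Ux) e e0.
  by apply=> //; exact: ballxx.
have [d d0 hd] := whitney_interior Ua e0; exists d => //.
have approx y (k : R) : closure U y -> ball a d y -> 0 < k ->
    exists y', [/\ U y', ball a d y', `|y' - y| <= k & `|f y' - fb y| <= k].
  move=> Uy By k0; have [s s0 hs] := hfb y Uy k k0.
  have [r r0 rB] := open_ball (ball_open a d) By.
  have m0 : 0 < Num.min (Num.min r s) k by rewrite !lt_min r0 s0.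
  have [y' [Uy' By']] := Uy _ (nbhsx_ballx y _ m0).
  move: By'; rewrite ballE !lt_min -andbA => /and3P[yr ys yk].
  exists y'; split=> //; first by apply: rB; rewrite ballE.
    exact: ltW.
  by apply: hs => //; rewrite ballE.
move=> y z [Uy By] [Uz Bz]; apply/ler_addgt0Pl => k k0.
pose c := 2 * (e + 1 + `|G a|).
have c0 : 0 < c by rewrite mulr_gt0// ltr_wpDr// addr_gt0.
have [q kc0 kE] : exists2 q, 0 < q & k = q * c.
  by exists (k / c); [exact: divr_gt0 | rewrite divfK// gt_eqF].

have [y' [Uy' By' y1 y2]] := approx y _ Uy By kc0.
have [z' [Uz' Bz' z1 z2]] := approx z _ Uz Bz kc0.
have -> : fb y - G a y - (fb z - G a z) =
    ((f y' - G a y' - (f z' - G a z')) - (f y' - fb y) + (f z' - fb z)) +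
    (G a (y' - y) - G a (z' - z)) by rewrite !linearB; lmod.
have yz : `|y' - z'| <= `|y - z| + 2 * q.
  have -> : y' - z' = (y - z) + (y' - y) - (z' - z) by lmod.
  rewrite (le_trans (ler_normB _ _))// (le_trans (lerD (ler_normD _ _) (lexx _)))//.
  by lra.
have h0 : `|f y' - G a y' - (f z' - G a z')| <= e * (`|y - z| + 2 * q).
  by rewrite (le_trans (hd _ _ _ _))// ler_pM2l.
have g1 u : `|u| <= q -> `|G a u| <= `|G a| * q.
  by move=> h; rewrite (le_trans (clin_norm _ _))// ler_wpM2l.
rewrite (le_trans (ler_normD _ _))// (le_trans (lerD (ler_normD _ _) (ler_normB _ _)))//.
rewrite (le_trans (lerD (lerD (ler_normB _ _) (lexx _)) (lerD (g1 _ y1) (g1 _ z1))))//.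
have -> : k + e * `|y - z| = (e * (`|y - z| + 2 * q) + q + q) +
   (`|G a| * q + `|G a| * q).
  by rewrite kE /c; ring.
by rewrite lerD2r !lerD.
Qed.

End Whitney.

(** * Distance functions and approximation on balls *)

Section Dist.
Context {R : realType} {X : normedModType R}.
Variable A : set X.
Hypothesis A0 : A !=set0.

Definition dist (z : X) : R := inf [set `|z - a| | a in A].

Lemma dist_le z a : A a -> dist z <= `|z - a|.
Proof. by move=> Aa; apply: ge_inf; [exists 0 => _ [? _ <-] | exists a]. Qed.

Lemma le_dist z (c : R) : (forall a, A a -> c <= `|z - a|) -> c <= dist z.
Proof.
move=> h; apply: lb_le_inf; last by move=> _ [a Aa <-]; exact: h.
by have [a Aa] := A0; exists `|z - a|, a.
Qed.

Lemma dist_ge0 z : 0 <= dist z. Proof. by apply: le_dist. Qed.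

Lemma dist_lt z (c : R) : dist z < c -> exists2 a, A a & `|z - a| < c.
Proof.
move=> zc; apply: contrapT => h; move: zc; rewrite ltNge => /negP; apply.
by apply: le_dist => a Aa; rewrite leNgt; apply/negP => zac; apply: h; exists a.
Qed.

Lemma dist_triangle y z : dist y <= dist z + `|y - z|.
Proof.
rewrite -lerBlDr; apply: le_dist => a Aa; rewrite lerBlDr addrC.
by rewrite (le_trans (dist_le _ Aa))// ler_distD.
Qed.

Lemma dist_lip : lip 1 setT (dist : X -> R^o).
Proof.
move=> y z _ _; rewrite mul1r ler_norml; apply/andP; split.
  by have := dist_triangle z y; rewrite distrC; lra.
by have := dist_triangle y z; lra.
Qed.

Lemma dist_eq0 a : A a -> dist a = 0.
Proof.
by move=> Aa; apply/eqP; rewrite eq_le dist_ge0 andbT (le_trans (dist_le a Aa))// subrr normr0.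
Qed.

Lemma dist_gt0 z : closed A -> ~ A z -> 0 < dist z.
Proof.
move=> cA nAz; have [r r0 rA] := open_ball (closed_openC cA) nAz.
apply: (lt_le_trans r0); apply: le_dist => a Aa.
by rewrite leNgt; apply/negP => zar; apply: (rA a) => //; rewrite ballE distrC.
Qed.

End Dist.

Lemma lipschitzE {R : realType} {X Y : normedModType R} (L : R) (A : set X)
  (f : X -> Y) : L.-lipschitz_A f <-> lip L A f.
Proof.
split=> [fA y z Ay Az|fA [y z] [/= Ay Az]]; last exact: fA.
exact: (fA (y, z)).
Qed.

Lemma sdiff_affine {R : realType} {X : normedModType R} (a : R) (b x : X) :
  sdiff (fun z => a *: z + b) x.
Proof.
have [||T TE] := @bounded_linear_clin R X X (fun z => a *: z) `|a|.
- by move=> c u v; lmod.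
- by move=> u; rewrite normrZ.
apply: sdiffD; last exact: sdiff_cst.
by apply: (sdiff_ext (f := T) ltr01); [move=> y _; rewrite TE | exact: sdiff_clin].
Qed.

Definition ball_approximation {R : realType} (X Y : normedModType R) (C : R) :=
  forall (x : X) (r L e : R) (f : X -> Y), 0 < r -> 0 <= L -> 0 < e ->
  lip L (ball x r) f ->
  exists g : X -> Y, [/\ lip (C * L) (ball x r) g,
    forall z, ball x r z -> sdiff g z &
    forall z, ball x r z -> `|f z - g z| <= e].

(** Translation and scaling carry the approximation property of the unit ball to
    every ball, with the same constant. *)
Lemma LA_ball {R : realType} (X Y : normedModType R) : LA (Some 1%N) X Y ->
  exists2 C : R, 0 <= C & ball_approximation X Y C.
Proof.
move=> [C [C0 hC]]; exists C => // x r L e f r0 L0 e0 fL.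
pose f' u := f (x + r *: u).
have rn0 : r != 0 by rewrite gt_eqF.
have B1 u : ball (0 : X) 1 u -> ball x r (x + r *: u).
  by rewrite !ballE subr0 addrC addKr normrZ gtr0_norm// gtr_pMr.
have B2 z : ball x r z -> ball (0 : X) 1 (r^-1 *: (z - x)).
  by rewrite !ballE subr0 normrZ gtr0_norm ?invr_gt0// mulrC ltr_pdivrMr// mul1r.
have f'L : Lipschitz_mapping (L * r) (ball 0 1) f'.
  split; first by rewrite mulr_ge0// ltW.
  apply/lipschitzE => y z By Bz; rewrite (le_trans (fL _ _ (B1 _ By) (B1 _ Bz)))//.
  have -> : x + r *: y - (x + r *: z) = r *: (y - z) by lmod.
  by rewrite normrZ gtr0_norm// mulrA.
have [g [[_ /lipschitzE gL] gC ge]] := hC _ _ f'L e e0.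
exists (fun z => g (r^-1 *: (z - x))); split.
- move=> y z By Bz; rewrite (le_trans (gL _ _ (B2 _ By) (B2 _ Bz)))//.
  have -> : r^-1 *: (y - x) - r^-1 *: (z - x) = r^-1 *: (y - z) by lmod.
  rewrite normrZ gtr0_norm ?invr_gt0// le_eqVlt; apply/orP; left; apply/eqP.
  by rewrite !mulrA mulfK.
- move=> z Bz; apply: (@sdiff_comp _ _ _ _ (fun z => r^-1 *: (z - x)) g).
    rewrite (_ : (fun z => _) = (fun z => r^-1 *: z + r^-1 *: (- x))).
      exact: sdiff_affine.
    by apply/funext => y; lmod.
  by exists (frechet g (r^-1 *: (z - x))); apply: Ck1_sderiv gC (B2 _ Bz); exact: ball_open.
- move=> z Bz; rewrite -lee_fin (le_trans _ ge)//.
  apply: ereal_sup_ubound; exists (r^-1 *: (z - x)); first exact: B2.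
  by rewrite /f' scalerA divff// scale1r subrKC.
Qed.

(** * A smooth step *)

Section SmoothStep.
Context {R : realType}.

Definition sqpos (t : R) : R^o := (Num.max 0 t) ^+ 2.

Lemma sqpos_sdiff (t : R^o) : sdiff sqpos t.
Proof.
have [||T TE] := @bounded_linear_clin R R^o R^o
    (fun u => (2 * Num.max 0 t) * u : R) `|2 * Num.max 0 t|.
- move=> c u v; set m := 2 * Num.max 0 t.
  by change (m * (c * u + v) = c * (m * u) + m * v); ring.
- by move=> u; rewrite normrM.
exists T => e e0; exists (e / 4); first by rewrite divr_gt0.
move=> y z; rewrite !ballE !TE /sqpos => By Bz.
have P u : `|Num.max 0 u - Num.max 0 t| <= `|u - t|.
  by case: (leP 0 u); case: (leP 0 t); rewrite ?subrr ?normr0// => h1 h2;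
    rewrite !ler_norml; have := ler_norm (u - t); have := ler_norm (t - u);
    rewrite (distrC t); lra.
have K : `|Num.max 0 y ^+ 2 - Num.max 0 z ^+ 2 - 2 * Num.max 0 z * (y - z)| <=
    `|y - z| * `|y - z|.
  have -> : `|y - z| * `|y - z| = (y - z) ^+ 2 by rewrite -expr2 real_normK ?num_real.
  clear; move: (y : R) (z : R) => {}y {}z.
  have := sqr_ge0 (y - z); have := sqr_ge0 y; have := sqr_ge0 z; rewrite !expr2.
  by case: (leP 0 y); case: (leP 0 z) => z0 y0 *; rewrite ler_norml;
    apply/andP; split; nra.
have -> : Num.max 0 y ^+ 2 - 2 * Num.max 0 t * y -
    (Num.max 0 z ^+ 2 - 2 * Num.max 0 t * z) =
    (Num.max 0 y ^+ 2 - Num.max 0 z ^+ 2 - 2 * Num.max 0 z * (y - z)) +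
    2 * (Num.max 0 z - Num.max 0 t) * (y - z) by ring.
rewrite (le_trans (ler_normD _ _))// (le_trans (lerD K (lexx _)))//.
rewrite !normrM (ger0_norm (x := 2))// -mulrDl ler_wpM2r//.
by have := P z; have := ler_distD t y z; rewrite (distrC t z); lra.
Qed.

(** A continuously differentiable step from [0] on the negative half-line to [1]
    beyond [1]. *)
Definition smoothstep (t : R) : R^o := 1 - sqpos (1 - sqpos t).

Lemma smoothstep_sdiff (t : R^o) : sdiff smoothstep t.
Proof.
have aff (g : R^o -> R^o) u : sdiff g u -> sdiff (fun t => 1 - g t : R^o) u.
  move=> gu; have := sdiff_comp gu (sdiff_affine (-1) (1 : R^o) (g u)).
  by apply: (sdiff_ext ltr01) => y _ /=; rewrite scaleN1r addrC.
by apply/aff/(sdiff_comp (aff _ _ (sqpos_sdiff t)))/sqpos_sdiff.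
Qed.

Lemma smoothstep0 t : t <= 0 -> smoothstep t = 0.
Proof.
move=> t0; rewrite /smoothstep /sqpos (max_l t0) expr0n/= subr0.
by rewrite (max_r ler01) expr1n subrr.
Qed.

Lemma smoothstep1 t : 1 <= t -> smoothstep t = 1.
Proof.
move=> t1; have t0 : 0 <= t by lra.
rewrite /smoothstep /sqpos (max_r t0) (max_l (y := 1 - _)); first by rewrite expr0n subr0.
nra.
Qed.

Lemma smoothstep01 t : 0 <= smoothstep t <= 1.
Proof.
rewrite /smoothstep /sqpos; set a := Num.max 0 t ^+ 2.
have a0 : 0 <= a by rewrite sqr_ge0.
by case: (leP 0 (1 - a)) => h; apply/andP; split; nra.
Qed.

Lemma smoothstep_lip : lip 4 setT smoothstep.
Proof.
move=> y z _ _.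
have sq a b : a <= 1 -> b <= 1 -> `|sqpos a - sqpos b| <= 2 * `|a - b|.
  move=> a1 b1; rewrite /sqpos.
  wlog ab : a b a1 b1 / b <= a.
    move=> h; have [ba|/ltW ab] := leP b a; first exact: h.
    by rewrite distrC (distrC a b); exact: h.
  have -> : `|a - b| = a - b by rewrite ger0_norm// subr_ge0.
  case: (leP 0 a); case: (leP 0 b); rewrite ?expr0n/= => b0 a0;
    rewrite ler_norml; apply/andP; split; nra.
have sm t : smoothstep t = smoothstep (Num.min 1 t).
  by case: (leP 1 t) => // t1; rewrite !smoothstep1.
have m1 (t : R) : Num.min 1 t <= 1 by rewrite ge_min lexx.
have ss t : 1 - sqpos t <= 1 by rewrite lerBlDr lerDl sqr_ge0.
have sB (a b : R) : 1 - a - (1 - b) = b - a by ring.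
have sq2 := sq _ _ (m1 y) (m1 z); have sq1 := sq _ _ (ss (Num.min 1 y)) (ss (Num.min 1 z)).
rewrite (sm y) (sm z) [_ - _]sB distrC (le_trans sq1)// sB distrC.
suff : `|Num.min 1 y - Num.min 1 z| <= `|y - z| by lra.
by case: (leP 1 y); case: (leP 1 z); rewrite ?subrr ?normr0// => h1 h2;
  rewrite !ler_norml; have := ler_norm (y - z); have := ler_norm (z - y);
  rewrite (distrC z); lra.
Qed.

End SmoothStep.

(** * Smooth bumps *)

Section Bump.
Context {R : realType} {X Y : normedModType R}.
Variables (C : R) (e0 : Y).
Hypotheses (C0 : 0 <= C) (hLA : ball_approximation X Y C) (e0_neq0 : e0 != 0).

(** Smooth the function [dist E] times a unit vector of [Y], return to scalars by
    a norming functional, and compose with a smooth step. Boundedness of [E]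
    matters because the approximation is only available on balls. *)
Lemma bump (E : set X) (n r : R) : 0 < r -> E `<=` ball 0 n ->
  exists (w : X -> R^o) (M : R), [/\ 0 <= M, lip M setT w,
    forall z, 0 <= w z <= 1, forall z, sdiff w z &
    (forall z x, E x -> `|z - x| < r / 8 -> w z = 1) /\
    (forall z, (forall x, E x -> r <= `|z - x|) -> w z = 0)].
Proof.
move=> r0 En; have [[x0 Ex0]|E0] := pselect (E !=set0); last first.
  exists (fun=> 0), 0; split=> //.
  - by move=> y z _ _; rewrite subrr normr0 mul0r.
  - by move=> z; rewrite lexx ler01.
  - by move=> z; exact: sdiff_cst.
  - by split=> // z x Ex; case: E0; exists x.
have En0 : E !=set0 by exists x0.
have n0 : 0 < n by have := En _ Ex0; rewrite ballE; apply: le_lt_trans.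
have [phi [phie phin]] := Hahn_Banach_norming e0.
have phiZ a u : phi (a *: u) = a * phi u :> R by exact: linearZ.
have phiB u v : phi (u - v) = phi u - phi v by exact: linearB.
have ne0 : 0 < `|e0| by rewrite normr_gt0.
(* The bump vanishes outside [ball 0 (n + r)], so that it can be extended by
   zero across the boundary of [ball 0 N]. *)
pose N := n + r + 1.
have N0 : 0 < N by rewrite /N; lra.
pose f z := (dist E z / `|e0|) *: e0.
have fl : lip 1 (ball 0 N) f.
  move=> y z _ _; rewrite -scalerBl -mulrBl normrZ normrM normfV normr_id.
  by rewrite divfK ?gt_eqF//; exact: dist_lip.
have r80 : 0 < r / 8 by rewrite divr_gt0.
have [g [gl gs gf]] := hLA N0 ler01 r80 fl.
have phig z : ball 0 N z -> `|dist E z - phi (g z)| <= r / 8.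
  move=> Bz; have -> : dist E z = phi (f z) :> R^o.
    by rewrite /f phiZ phie divfK// gt_eqF.
  by rewrite -phiB (le_trans (phin _))// gf.
pose q z : R^o := smoothstep (3 / 2 - 2 / r * phi (g z)).
have q0 z : ball 0 N z -> (forall x, E x -> r <= `|z - x|) -> q z = 0.
  move=> Bz Ez; apply: smoothstep0.
  have := phig z Bz; rewrite ler_norml => /andP[_ h].
  have : r <= dist E z by exact: le_dist.
  have -> : 3 / 2 - 2 / r * phi (g z) <= 0 = (3 / 2 * r - 2 * phi (g z) <= 0).
    rewrite -[RHS](pmulr_lle0 _ (x := r^-1)) ?invr_gt0//.
    by congr (_ <= _); field; rewrite gt_eqF.
  by lra.
have q1 z x : ball 0 N z -> E x -> `|z - x| < r / 8 -> q z = 1.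
  move=> Bz Ex zx; apply: smoothstep1.
  have := phig z Bz; rewrite ler_norml => /andP[h _].
  have := dist_le z Ex => h'.
  have -> : 1 <= 3 / 2 - 2 / r * phi (g z) = (0 <= r / 2 - 2 * phi (g z)).
    rewrite -[RHS](pmulr_lge0 _ (x := r^-1)) ?invr_gt0// -subr_ge0.
    by congr (_ <= _); field; rewrite gt_eqF.
  by lra.
have far z x : n + r <= `|z| -> E x -> r <= `|z - x|.
  move=> zn /En; rewrite ballE subr0 => xn.
  by have := ler_normB z (z - x); rewrite subKr; have := lerB_dist z x; lra.
pose w z : R^o := if `|z| < N then q z else 0.
have wq z : `|z| < N -> w z = q z by rewrite /w => ->.
have w0 z : (forall x, E x -> r <= `|z - x|) -> w z = 0.
  by move=> h; rewrite /w; case: ifP => // zN; apply: q0; rewrite // ballE subr0.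
pose M := 4 * (2 / r * C).
have M0 : 0 <= M by rewrite !mulr_ge0// invr_ge0 ltW.
have ql : lip M (ball 0 N) q.
  have diffE (a b : R) : 3 / 2 - 2 / r * a - (3 / 2 - 2 / r * b) = - (2 / r * (a - b)).
    by ring.
  move=> y z By Bz; rewrite (le_trans (smoothstep_lip I I))//.
  rewrite [X in _ * `|X|](diffE (phi (g y)) (phi (g z))) normrN normrM.
  rewrite gtr0_norm ?divr_gt0// /M -!mulrA !ler_pM2l ?invr_gt0//.
  rewrite -phiB (le_trans (phin _))//.
  by rewrite (le_trans (gl _ _ By Bz))// mulr1.
have qs z : ball 0 N z -> sdiff q z.
  move=> Bz; have h1 := sdiff_comp (gs z Bz) (sdiff_clin phi (g z)).
  have h2 := sdiff_comp h1 (sdiff_affine (- (2 / r)) (3 / 2 : R^o) _).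
  have := sdiff_comp h2 (smoothstep_sdiff _).
  apply: (sdiff_ext ltr01) => y _ /=; congr smoothstep.
  by rewrite addrC -[_ *: _]/(_ * _) mulNr.
have cover z : (ball 0 N z) \/ (forall y, ball z 1 y -> w y = 0).
  have [zN|zN] := ltP `|z| N; [by left; rewrite ballE subr0 | right => y yz].
  apply: w0 => x Ex; apply: far => //; move: yz zN; rewrite /N ballE distrC.
  by have := lerB_dist z y; lra.
exists w, M; split=> //.
- apply: lip_at_convex => // z _; have [Bz|z0] := cover z.
    have [d d0 dB] := open_ball (ball_open (0 : X) N) Bz.
    have wB y : ball 0 N y -> w y = q y by rewrite ballE subr0; exact: wq.
    by exists d => // y /dB By; rewrite !wB//; exact: ql.
  exists 1 => // y Bz; rewrite !z0//; last exact: ballxx.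
  by rewrite subrr normr0 mulr_ge0.
- by move=> z; rewrite /w; case: ifP => _; [exact: smoothstep01 | rewrite lexx ler01].
- move=> z; have [Bz|z0] := cover z.
    have [d d0 dB] := open_ball (ball_open (0 : X) N) Bz.
    apply: (sdiff_ext d0 _ (qs z Bz)) => y /dB; rewrite ballE subr0 => yN.
    by rewrite wq.
  by apply: (sdiff_ext ltr01 _ (sdiff_cst 0 z)) => y /z0.
- split=> // z x Ex zx; have zN : `|z| < N.
    have := En _ Ex; rewrite ballE subr0 => xn.
    by have := lerB_dist z x; rewrite /N; lra.
  by rewrite wq//; apply: q1 zx => //; rewrite ballE subr0.
Qed.

End Bump.

(** * Partitions of unity *)

Section PartitionOfUnity.
Context {R : realType} {X Y : normedModType R}.
Variables (C : R) (e0 : Y).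
Hypotheses (C0 : 0 <= C) (hLA : ball_approximation X Y C) (e0_neq0 : e0 != 0).
Variable U : X -> set X.
Hypothesis oU : forall i, open (U i).

(** If each of [x] and [x'] lies in the member of the cover chosen for the other,
    then each chosen index is at most the other. *)
Lemma least_index : exists alpha : X -> X,
  (forall x, (exists i, U i x) -> U (alpha x) x) /\
  (forall x x', U (alpha x) x' -> U (alpha x') x -> alpha x = alpha x').
Proof.
have [Q wQ] := well_ordering_principle X.
have /choice[alpha hal] : forall x, exists i, (exists k, U k x) ->
    U i x /\ forall k, U k x -> Q i k.
  move=> x; have [[k Uk]|nU] := pselect (exists k, U k x); last by exists x.
  have [|i [[Ui imin] _]] := wQ [pred i | `[< U i x >]].
    by exists k; exact/asboolP.
  exists i => _; split; first exact/asboolP.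
  by move=> l Ul; apply: imin; exact/asboolP.
exists alpha; split=> [x /hal[]//|x x' xx' x'x].
have [_ /(_ _ x'x) Q1] := hal x (ex_intro _ _ x'x).
have [_ /(_ _ xx') Q2] := hal x' (ex_intro _ _ xx').
have Qrefl a : Q a a.
  have [|m [[+ mmin] _]] := wQ (pred1 a); first by exists a; rewrite inE.
  by rewrite inE => /eqP ma; have := mmin a; rewrite ma inE eqxx; apply.
have [|m [_ mu]] := wQ (pred2 (alpha x) (alpha x')).
  by exists (alpha x); rewrite inE/= eqxx.
rewrite -(mu (alpha x)) ?(mu (alpha x'))//.
  by split; [rewrite inE/= eqxx orbT | move=> k /=; rewrite !inE => /orP[]/eqP->].
by split; [rewrite inE/= eqxx | move=> k /=; rewrite !inE => /orP[]/eqP->].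
Qed.

Lemma min_radius (P : nat -> R -> Prop) :
  (forall n (d d' : R), d' <= d -> P n d -> P n d') ->
  (forall n, exists2 d : R, 0 < d & P n d) ->
  forall N, exists2 d : R, 0 < d & forall n, (n < N)%N -> P n d.
Proof.
move=> Pmono Pex; elim=> [|N [d d0 hd]]; first by exists 1.
have [d' d'0 hd'] := Pex N.
exists (Num.min d d'); first by rewrite lt_min d0.
move=> n; rewrite ltnS leq_eqVlt => /predU1P[->|nN].
  by apply: Pmono hd'; rewrite ge_min lexx orbT.
by apply: Pmono (hd n nN); rewrite ge_min lexx.
Qed.

Lemma lip_mul01 (a b : X -> R^o) (L M : R) :
  (forall y, 0 <= a y <= 1) -> (forall y, 0 <= b y <= 1) ->
  lip L setT a -> lip M setT b -> lip (L + M) setT (fun y => (a y : R) * b y : R^o).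
Proof.
move=> a01 b01 aL bM y z _ _.
have mul01 (p q s t u v : R) : 0 <= q <= 1 -> 0 <= s <= 1 ->
    `|p - s| <= u -> `|q - t| <= v -> `|p * q - s * t| <= u + v.
  move=> /andP[q0 q1] /andP[s0 s1] pu qv.
  have -> : p * q - s * t = (p - s) * q + s * (q - t) by ring.
  rewrite (le_trans (ler_normD _ _))// !normrM (ger0_norm q0) (ger0_norm s0) lerD//.
    by rewrite (le_trans _ pu)// ler_piMr.
  by rewrite (le_trans _ qv)// ler_piMl.
by rewrite mulrDl; apply: mul01; [exact: b01 | exact: a01 | exact: aL | exact: bM].
Qed.

(** Multiplying by [1 - w k] for all [k < n] makes the pieces add up to [1] as
    soon as one [w k] equals [1], and makes all later pieces vanish there. *)
Definition partition_piece (w : nat -> X -> R^o) (n : nat) (y : X) : R^o :=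
  (w n y : R) * \prod_(k < n) (1 - w k y : R).

Lemma sum_partition_piece (w : nat -> X -> R^o) N y :
  \sum_(n < N) partition_piece w n y = 1 - \prod_(k < N) (1 - w k y : R).
Proof.
elim: N => [|N ih]; first by rewrite !big_ord0 subrr.
by rewrite !big_ord_recr/= ih /partition_piece; ring.
Qed.

(** A well-ordering of the indices assigns to each point [x] the least index
    [alpha x] of a member of the cover that contains it. For a fixed scale [r]
    consider the points [x] whose ball of radius [3 * r] lies in [U (alpha x)]:
    two of them closer than [3 * r] share their index. Hence one bump function
    per scale suffices, and the cover is replaced by a countable one in which
    the index is locally constant on each member. *)
Lemma partition_of_unity :
  exists (psi : nat -> X -> R^o) (M : nat -> R) (i : nat -> X -> X),
  [/\ forall n, 0 <= M n, forall n y, 0 <= psi n y,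
      forall n, lip (M n) setT (psi n), forall n y, sdiff (psi n) y &
  forall z, (exists k, U k z) -> exists (N : nat) (d : R) (j : nat -> X),
   [/\ 0 < d,
     forall y, ball z d y -> \sum_(n < N) psi n y = 1,
     forall y, ball z d y -> forall n, (N <= n)%N -> psi n y = 0,
     forall n, (n < N)%N -> ball z d `<=` U (j n) &
     forall n, (n < N)%N -> forall y, ball z d y -> psi n y != 0 -> i n y = j n]].
Proof.
have [alpha [aU asep]] := least_index.
pose r (n : nat) : R := n.+1%:R^-1.
have r0 n : 0 < r n by rewrite invr_gt0.
(* The points of scale [r n]; restricting them to a bounded set makes the bump
   function available and still exhausts the union of the cover. *)
pose E n := [set x | [/\ ball (0 : X) n.+1%:R x, exists k, U k x &
  ball x (3 * r n) `<=` U (alpha x)]].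
have Esep n x x' : E n x -> E n x' -> `|x - x'| < 3 * r n -> alpha x = alpha x'.
  move=> [_ _ xU] [_ _ xU'] xx'; apply: asep.
    by apply: xU; rewrite ballE distrC.
  by apply: xU'; rewrite ballE.
have Ecover x : (exists k, U k x) -> exists n, E n x.
  move=> Ux; have [rho rho0 hrho] := open_ball (oU _) (aU x Ux).
  have [a ha] : exists n : nat, `|x| < n%:R.
    by exists (Num.truncn `|x|).+1; exact: truncnS_gt.
  have [b hb] : exists n : nat, 3 / rho < n%:R.
    by exists (Num.truncn (3 / rho)).+1; exact: truncnS_gt.
  exists (a + b)%N; split=> //.
    rewrite ballE subr0 (lt_le_trans ha)// ler_nat.
    by rewrite (leq_trans (leq_addr b a)).
  apply: subset_trans hrho; apply: le_ball.
  rewrite ler_pdivrMr// mulrC -ler_pdivrMr// ltW// (lt_le_trans hb)// ler_nat.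
  by rewrite (leq_trans (leq_addl a b)).
have /choice[w /choice[L hw]] : forall n, exists (w : X -> R^o) (L : R),
   [/\ 0 <= L, lip L setT w,
    forall z, 0 <= w z <= 1, forall z, sdiff w z &
    (forall z x, E n x -> `|z - x| < r n / 8 -> w z = 1) /\
    (forall z, (forall x, E n x -> r n <= `|z - x|) -> w z = 0)].
  by move=> n; apply: (bump C0 hLA e0_neq0 (n := n.+1%:R)) => // x [].
have w01 n z : 0 <= w n z <= 1 by have [_ _] := hw n.
have w01' n z : 0 <= (1 - w n z : R) <= 1.
  by have /andP[h1 h2] := w01 n z; rewrite subr_ge0 h2 lerBlDr lerDl.
pose P n y : R^o := \prod_(k < n) (1 - w k y : R).
have P01 n y : 0 <= P n y <= 1.
  rewrite /P; elim: n => [|n ih]; first by rewrite big_ord0 ler01 lexx.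
  rewrite big_ord_recr/=; have [/andP[i0 i1] /andP[k0 k1]] := (ih, w01' n y).
  by rewrite mulr_ge0//= mulr_ile1.
have PL n : exists2 K : R, 0 <= K & lip K setT (P n).
  elim: n => [|n [K K0 hK]].
    by exists 0 => // y z _ _; rewrite /P !big_ord0 subrr normr0 mul0r.
  have [Ln0 Ln _ _ _] := hw n.
  exists (K + L n); first exact: addr_ge0.
  have := lip_mul01 (P01 n) (w01' n) hK; rewrite /P => h.
  move=> y z _ _; rewrite !big_ord_recr/=; apply: h => // y' z' _ _.
  have sB (a b : R) : 1 - a - (1 - b) = b - a by ring.
  by rewrite [X in `|X| <= _]sB distrC; exact: Ln.
have Ps n y : sdiff (P n) y.
  elim: n => [|n ih].
    by apply: (sdiff_ext ltr01 _ (sdiff_cst (1 : R^o) y)) => z _; rewrite /P big_ord0.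
  have [_ _ _ wn _] := hw n.
  have h := sdiff_comp (wn y) (sdiff_affine (-1) (1 : R^o) (w n y)).
  apply: (sdiff_ext ltr01 _ (sdiffZ ih h)) => z _ /=.
  by rewrite /P big_ord_recr/= scaleN1r addrC.
have /choice[M hM] : forall n, exists K : R, 0 <= K /\ lip K setT (partition_piece w n).
  move=> n; have [K K0 hK] := PL n; have [Ln0 Ln _ _ _] := hw n.
  by exists (L n + K); split; [exact: addr_ge0 |
    exact: (lip_mul01 (w01 n) (P01 n) Ln hK)].
have /choice[i hi] : forall n, exists i : X -> X, forall y x, E n x ->
    `|y - x| < r n -> i y = alpha x.
  move=> n; suff /choice[i hi] : forall y, exists k, forall x, E n x ->
    `|y - x| < r n -> k = alpha x by exists i.
  move=> y; have [[x [Ex yx]]|ny] := pselect (exists x, E n x /\ `|y - x| < r n).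
    exists (alpha x) => x' Ex' yx'; apply: (Esep n) => //.
    have := ler_distD y x x'; rewrite (distrC x y); have := r0 n; lra.
  by exists y => x Ex yx; case: ny; exists x.
exists (partition_piece w), M, i; split.
- by move=> n; have [] := hM n.
- move=> n y; have /andP[h1 _] := w01 n y; have /andP[h2 _] := P01 n y.
  exact: (@mulr_ge0 R _ _ h1 h2).
- by move=> n; have [] := hM n.
- by move=> n y; have [_ _ _ wn _] := hw n; exact: (sdiffZ (wn y) (Ps n y)).
move=> z Uz; have [N0 EN0] := Ecover z Uz.
pose N := N0.+1.
have wN y : ball z (r N0 / 8) y -> w N0 y = 1.
  by rewrite ballE => yz; have [_ _ _ _ [h _]] := hw N0; exact: h EN0 yz.
have PN y n : ball z (r N0 / 8) y -> (N <= n)%N -> P n y = 0.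
  move=> By Nn; apply/eqP; rewrite prodf_seq_eq0; apply/hasP.
  by exists (Ordinal Nn); rewrite ?mem_index_enum//= wN// subrr.
pose loc n (d : R) := exists j, ball z d `<=` U j /\
  forall y, ball z d y -> partition_piece w n y != 0 -> i n y = j.
have locmono n (d d' : R) : d' <= d -> loc n d -> loc n d'.
  move=> dd [j [h1 h2]]; exists j; split.
    by apply: subset_trans h1; exact: le_ball.
  by move=> y By; apply: h2; exact: le_ball By.
have locex n : exists2 d : R, 0 < d & loc n d.
  have [[x [Ex zx]]|nz] := pselect (exists x, E n x /\ `|z - x| < 3 / 2 * r n).
    exists (r n / 2); first by rewrite divr_gt0.
    exists (alpha x); split=> [y|y].
      rewrite ballE => yz; have [_ _] := Ex; apply; rewrite ballE.
      by have := ler_distD z y x; have := r0 n; lra.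
    rewrite ballE => yz yn0.
    have [[x' [Ex' yx']]|ny] := pselect (exists x, E n x /\ `|y - x| < r n).
      rewrite (hi n y x')//; apply: (Esep n) => //.
      have := ler_distD z x' x; have := ler_distD y x' z.
      by rewrite (distrC x' y); have := r0 n; lra.
    exfalso; move/eqP: yn0; apply.
    rewrite /partition_piece; have [_ _ _ _ [_ ->]] := hw n; first by rewrite mul0r.
    by move=> x' Ex'; rewrite leNgt; apply/negP => h; apply: ny; exists x'.
  have [rho rho0 hrho] := open_ball (oU _) (aU z Uz).
  exists (Num.min rho (r n / 2)); first by rewrite lt_min rho0 divr_gt0.
  exists (alpha z); split.
    by apply: subset_trans hrho; apply: le_ball; rewrite ge_min lexx.
  move=> y; rewrite ballE lt_min => /andP[_ yz] /eqP[].
  rewrite /partition_piece; have [_ _ _ _ [_ ->]] := hw n; first by rewrite mul0r.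
  move=> x' Ex'; rewrite leNgt; apply/negP => h; apply: nz; exists x'; split=> //.
  by have := ler_distD y z x'; rewrite (distrC z y); lra.
have [d d0 hd] := min_radius locmono locex N.
have /choice[j hj] : forall n, exists j, (n < N)%N -> ball z d `<=` U j /\
  forall y, ball z d y -> partition_piece w n y != 0 -> i n y = j.
  move=> n; have [nN|nN] := ltnP n N; last by exists z.
  by have [j hj] := hd n nN; exists j.
exists N, (Num.min d (r N0 / 8)), j; split.
- by rewrite lt_min d0 divr_gt0.
- move=> y By; rewrite sum_partition_piece -/(P N y) PN ?subr0//.
  by apply: le_ball By; rewrite ge_min lexx orbT.
- move=> y By n Nn; rewrite /partition_piece -/(P n y) PN ?mulr0//.
  by apply: le_ball By; rewrite ge_min lexx orbT.
- move=> n nN; have [h _] := hj n nN; apply: subset_trans h.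
  by apply: le_ball; rewrite ge_min lexx.
- move=> n nN y By; have [_ h] := hj n nN; apply: h.
  by apply: le_ball By; rewrite ge_min lexx.
Qed.

(** Which functions [h n k] are glued may be decided once the Lipschitz
    constants [M n] are known; this allows the errors of [h n k] to be small
    relative to them. *)
Lemma gluing : exists2 M : nat -> R, forall n, 0 <= M n &
  forall h : nat -> X -> X -> Y, exists g : X -> Y,
  forall z, (exists k, U k z) ->
  exists (N : nat) (d : R) (j : nat -> X) (psi : nat -> X -> R^o),
   [/\ 0 < d /\ (forall n, (n < N)%N -> ball z d `<=` U (j n)),
     forall n y, 0 <= psi n y,
     forall n, lip (M n) setT (psi n) /\ forall y, sdiff (psi n) y,
     forall y, ball z d y -> \sum_(n < N) psi n y = 1 &
     forall y, ball z d y -> g y = \sum_(n < N) (psi n y : R) *: h n (j n) y].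
Proof.
have [psi [M [i [M0 psi0 psiL psis loc]]]] := partition_of_unity.
exists M => // h.
have /choice[N hN] : forall y, exists N, (exists k, U k y) ->
    forall n, (N <= n)%N -> psi n y = 0.
  move=> y; have [/loc[N [d [_ [d0 _ h0 _ _]]]]|nU] := pselect (exists k, U k y).
    by exists N => _; apply: h0; exact: ballxx.
  by exists 0%N.
exists (fun y => \sum_(n < N y) (psi n y : R) *: h n (i n y) y) => z Uz.
have [N' [d [j [d0 h1 h0 hU hi]]]] := loc z Uz.
exists N', d, j, psi; split=> // y By.
have Uy : exists k, U k y.
  case: (posnP N') => [N'0|N'0]; last by exists (j 0%N); exact: hU.
  by have := h1 y By; rewrite N'0 big_ord0 => /eqP; rewrite eq_sym oner_eq0.
pose F n := (psi n y : R) *: h n (i n y) y.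
have trunc a b : (a <= b)%N -> (forall n, (a <= n)%N -> psi n y = 0) ->
    \sum_(n < a) F n = \sum_(n < b) F n.
  move=> ab a0; rewrite -!(big_mkord xpredT F) (big_cat_nat (leq0n a) ab)/=.
  rewrite [X in _ + X]big_nat_cond [X in _ + X]big1 ?addr0// => n /andP[/andP[an _] _].
  by rewrite /F a0// scale0r.
transitivity (\sum_(n < N') F n).
  have [NN|/ltnW NN] := leqP (N y) N'; first exact: trunc (hN y Uy).
  by rewrite -(trunc _ _ NN)//; exact: h0.
apply: eq_bigr => n _; have [p0|pn0] := eqVneq (psi n y) 0.
  by rewrite /F p0 !scale0r.
by rewrite /F hi.
Qed.

End PartitionOfUnity.

(** * Extensions with a small derivative error *)

(** The product rule for a partition of unity, in terms of Lipschitz constants: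
    the variation of the weights costs [M n] times the size of [b n]. *)
Lemma lip_weighted_sum {R : realType} {X Y : normedModType R} (B : set X)
    (N : nat) (psi : nat -> X -> R^o) (b : nat -> X -> Y) (L : R) (M beta : nat -> R) :
  (forall n y, 0 <= psi n y) ->
  (forall y, B y -> \sum_(n < N) psi n y = 1) ->
  (forall n, 0 <= M n) -> (forall n, lip (M n) setT (psi n)) ->
  (forall n, (n < N)%N -> lip L B (b n)) ->
  (forall n, (n < N)%N -> forall y, B y -> `|b n y| <= beta n) ->
  lip (L + \sum_(n < N) M n * beta n) B
    (fun y => \sum_(n < N) (psi n y : R) *: b n y).
Proof.
move=> psi0 psi1 M0 psiM bL bbeta y z By Bz.
have -> : \sum_(n < N) (psi n y : R) *: b n y - \sum_(n < N) (psi n z : R) *: b n z =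
    \sum_(n < N) (psi n y : R) *: (b n y - b n z) +
    \sum_(n < N) ((psi n y : R) - psi n z) *: b n z.
  by rewrite -sumrB -big_split; apply: eq_bigr => n _ /=; lmod.
rewrite (le_trans (ler_normD _ _))// mulrDl lerD//.
  rewrite (le_trans (ler_norm_sum _ _ _))//.
  apply: (@le_trans _ _ (\sum_(n < N) (psi n y : R) * (L * `|y - z|))).
    apply: ler_sum => n _; rewrite normrZ ger0_norm//.
    by rewrite ler_wpM2l//; exact: bL.
  by rewrite -mulr_suml (psi1 _ By) mul1r.
rewrite (le_trans (ler_norm_sum _ _ _))// mulr_suml ler_sum// => n _.
rewrite normrZ mulrAC; apply: ler_pM => //; first exact: psiM.
exact: bbeta.
Qed.

Section ApproximateExtension.
Context {R : realType} {X : normedModType R} {Y : completeNormedModType R}.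
Variables (C : R) (e0 : Y).
Hypotheses (C0 : 0 <= C) (hLA : ball_approximation X Y C) (e0_neq0 : e0 != 0).
Variables (A : set X) (f : X -> Y) (G : X -> clin X Y).
Hypotheses (hLLE : LLE A Y) (Gc : cont_on A G) (fW : whitney A f G).

(** The constant [K] of the local extension property depends on the point, but
    by the Whitney condition [f - G x] has an arbitrarily small Lipschitz
    constant near [x], so that [K] is absorbed. *)
Lemma local_extension (e : R) (x : X) : 0 < e -> A x ->
  exists (V : set X) (h : X -> Y), [/\ open V, V x &
    forall a, A a -> V a -> h a = f a /\ lip e V (fun y => h y - G a y)].
Proof.
move=> e0' Ax; have [K [K1 hK]] := hLLE Ax.
have K0 : 0 < K by exact: lt_le_trans K1.
have e20 : 0 < e / 2 by rewrite divr_gt0.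
have q0 : 0 < e / 2 / K by rewrite divr_gt0.
have [d d0 hd] := fW Ax q0; have [d' d'0 hd'] := Gc Ax e20.
have m0 : 0 < Num.min d d' by rewrite lt_min d0.
have [V [[oV Vx] VB hV]] := hK _ m0.
have VBd : V `<=` ball x d.
  by apply: subset_trans VB _; apply: le_ball; rewrite ge_min lexx.
have VBd' : V `<=` ball x d'.
  by apply: subset_trans VB _; apply: le_ball; rewrite ge_min lexx orbT.
have [|g [[_ /lipschitzE gL] gE]] := hV (e / 2 / K) (fun y => f y - G x y).
  split; first exact: ltW.
  by apply/lipschitzE; apply: lip_sub hd => y [Vy Ay]; split=> //; exact: VBd.
exists V, (fun y => g y + G x y); split=> // a Aa Va; split.
  by rewrite gE// subrK.
apply: (lip_ext (f := fun y => g y + (G x - G a) y)).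
  by move=> y _; rewrite clinB addrA.
rewrite [e]splitr; apply: lipD.
  by rewrite mulrC divfK ?gt_eqF// in gL.
apply: lipW (lip_clin (G x - G a) (A:=V)).
by rewrite -normrN opprB; apply: hd' => //; exact: VBd'.
Qed.

(** The local extensions all take the value [f a] at [a]. Subtracting the common
    value, the glued functions are small near [a], so that the variation of the
    partition of unity is harmless in a ball whose radius is small in terms of the
    Lipschitz constants of the finitely many weights that matter there. *)
Lemma approximate_extension (e : R) : 0 < e -> exists g : X -> Y,
  (forall a, A a -> g a = f a) /\
  forall a, A a -> exists2 d : R, 0 < d & lip e (ball a d) (fun y => g y - G a y).
Proof.
move=> epos; have e20 : 0 < e / 2 by rewrite divr_gt0.
have /choice[V /choice[h hV]] : forall x, exists (V : set X) (h : X -> Y),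
    [/\ open V, A x -> V x & forall a, A a -> V a ->
      h a = f a /\ lip (e / 2) V (fun y => h y - G a y)].
  move=> x; have [Ax|nAx] := pselect (A x).
    by have [V [h [oV Vx hV]]] := local_extension e20 Ax; exists V, h.
  by exists set0, (fun=> 0); split=> //; exact: open0.
have oV x : open (V x) by have [] := hV x.
have [M M0 glue] := gluing C0 hLA e0_neq0 oV.
have [g hg] := glue (fun _ => h).
have loc a : A a -> exists (N : nat) (d : R) (j : nat -> X) (psi : nat -> X -> R^o),
   [/\ 0 < d /\ (forall n, (n < N)%N -> ball a d `<=` V (j n)),
     forall n y, 0 <= psi n y,
     forall n, lip (M n) setT (psi n),
     forall y, ball a d y -> \sum_(n < N) psi n y = 1 &
     forall y, ball a d y -> g y = \sum_(n < N) (psi n y : R) *: h (j n) y].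
  move=> Aa; have [|N [d [j [psi [h1 h2 h3 h4 h5]]]]] := hg a.
    by exists a; have [_ + _] := hV a; exact.
  by exists N, d, j, psi; split=> // n; have [] := h3 n.
have hE a N d j : A a -> 0 < d -> (forall n, (n < N)%N -> ball a d `<=` V (j n)) ->
    forall n, (n < N)%N -> h (j n) a = f a /\
      lip (e / 2) (ball a d) (fun y => h (j n) y - G a y).
  move=> Aa d0 hV' n nN; have Va : V (j n) a by apply: hV' => //; exact: ballxx.
  have [_ _ /(_ a Aa Va)[h1 h2]] := hV (j n); split=> //.
  by apply: lip_sub h2; exact: hV'.
exists g; split=> a Aa; have [N [d [j [psi [[d0 h1] h2 h3 h4 h5]]]]] := loc a Aa.
  rewrite h5; last exact: ballxx.
  rewrite (eq_bigr (fun n : 'I_N => (psi n a : R) *: f a)).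
    by rewrite -scaler_suml h4 ?scale1r//; exact: ballxx.
  by move=> n _; have [->] := hE a N d j Aa d0 h1 n (ltn_ord n).
pose S := \sum_(n < N) M n.
have S0 : 0 <= S by rewrite sumr_ge0.
have S10 : 0 < S + 1 by rewrite ltr_wpDl.
pose d' := Num.min d (S + 1)^-1.
have d'0 : 0 < d' by rewrite lt_min d0 invr_gt0.
have d'd : d' <= d by rewrite ge_min lexx.
have d'S : S * d' <= 1.
  rewrite (@le_trans _ _ (S * (S + 1)^-1))//.
    by rewrite ler_wpM2l// ge_min lexx orbT.
  by rewrite ler_pdivrMr// mul1r lerDl.
exists d' => //.
pose b n y := h (j n) y - G a y - (f a - G a a).
apply: (lip_ext (f := fun y => \sum_(n < N) (psi n y : R) *: b n y + (f a - G a a))).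
  move=> y By; have By' : ball a d y by exact: le_ball By.
  rewrite h5// -[f a - _]scale1r -(h4 y By') scaler_suml -big_split/=.
  rewrite -[G a y in RHS]scale1r -[in RHS](h4 y By') scaler_suml -sumrB.
  by apply: eq_bigr => n _; rewrite /b; lmod.
have bL n : (n < N)%N -> lip (e / 2) (ball a d') (b n).
  move=> nN; have [_ h6] := hE a N d j Aa d0 h1 n nN.
  move=> y z By Bz.
  have -> : b n y - b n z = h (j n) y - G a y - (h (j n) z - G a z).
    by rewrite /b; lmod.
  by apply: h6; exact: le_ball d'd _ _.
apply: (@lipW _ _ _ (e / 2 + \sum_(n < N) M n * (e / 2 * d') + 0)).
  rewrite addr0 -mulr_suml -/S mulrCA.
  have : e / 2 * (S * d') <= e / 2 * 1 by rewrite ler_pM2l.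
  by lra.
apply: lipD; last by move=> y z _ _; rewrite subrr normr0 mul0r.
apply: (lip_weighted_sum (b := b) (beta := fun=> e / 2 * d')) => // [y By|n nN y By].
  by apply: h4; exact: le_ball By.
have ba : b n a = 0.
  by rewrite /b; have [-> _] := hE a N d j Aa d0 h1 n nN; rewrite subrr.
rewrite -[b n y]subr0 -ba (le_trans (bL n nN y a By (ballxx a d'0)))//.
by rewrite ler_pM2l//; move: By; rewrite ballE => /ltW.
Qed.

End ApproximateExtension.

(** * Extensions with the prescribed strict derivative on a set *)

Section Inradius.
Context {R : realType} {X : normedModType R}.
Variable N : set X.

(** A [1]-Lipschitz substitute for the distance to the complement of [N], which
    makes sense also when the complement is empty. *)
Definition inradius (z : X) : R :=
  sup [set r | 0 <= r <= 1 /\ ball z r `<=` N].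

Let radii0 z : [set r : R | 0 <= r <= 1 /\ ball z r `<=` N] 0.
Proof.
split; first by rewrite lexx ler01.
by move=> y; rewrite ballE => /(le_lt_trans (normr_ge0 _)); rewrite ltxx.
Qed.

Lemma le_inradius z r : 0 <= r <= 1 -> ball z r `<=` N -> r <= inradius z.
Proof.
by move=> r01 rN; apply: ub_le_sup => //; exists 1 => s [/andP[]].
Qed.

Lemma inradius_ge0 z : 0 <= inradius z.
Proof. by apply: ub_le_sup => //; exists 1 => s [/andP[]]. Qed.

Lemma inradius_le z c : (forall r, 0 <= r <= 1 -> ball z r `<=` N -> r <= c) ->
  inradius z <= c.
Proof. by move=> h; apply: ge_sup; [exists 0 | move=> r [r01 rN]; exact: h]. Qed.

Lemma inradius_notin z : ~ N z -> inradius z = 0.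
Proof.
move=> nNz; apply/eqP; rewrite eq_le inradius_ge0 andbT.
apply: inradius_le => r r01 rN; rewrite leNgt; apply/negP => r0.
by apply/nNz/rN; exact: ballxx.
Qed.

Lemma inradius_gt0 z : open N -> N z -> 0 < inradius z.
Proof.
move=> oN Nz; have [r r0 rN] := open_ball oN Nz.
have m0 : 0 < Num.min r 1 by rewrite lt_min r0 ltr01.
apply: (lt_le_trans m0); apply: le_inradius; first by rewrite ltW//= ge_min lexx orbT.
by apply: subset_trans rN; apply: le_ball; rewrite ge_min lexx.
Qed.

Lemma inradius_triangle y z : inradius y <= inradius z + `|y - z|.
Proof.
apply: inradius_le => r /andP[r0 r1] rN; rewrite -lerBlDr.
have [rs|rs] := leP 0 (r - `|y - z|); last by rewrite (le_trans (ltW rs))// inradius_ge0.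
apply: le_inradius; first by rewrite rs/= lerBlDr (le_trans r1)// lerDl.
by apply: subset_trans rN; apply: sub_ball; rewrite distrC addrC subrK.
Qed.

End Inradius.

Section Truncation.
Context {R : realType} {X Y : normedModType R}.
Variables (A : set X) (u : X -> Y) (e : R).
Hypotheses (A0 : A !=set0) (e_ge0 : 0 <= e) (uA : forall a, A a -> u a = 0).
Hypothesis uL : forall a, A a -> exists2 d : R, 0 < d & lip e (ball a d) u.

(** A map that vanishes on [A] and is [e]-Lipschitz near each point of [A] is
    multiplied by a cut-off that is [1] near [A]. The derivative of the cut-off
    is of order [(dist A)^-1], which [`|u z| <= e * dist A z] compensates. *)
Lemma truncation : exists v : X -> Y, [/\ lip (3 * e) setT v,
  forall a, A a -> v a = 0 &
  forall a, A a -> exists2 d : R, 0 < d & forall y, ball a d y -> v y = u y].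
Proof.
pose N := [set z | exists a (d : R), [/\ A a, lip e (ball a (3 * d)) u & ball a d z]].
have Nball a (d : R) : A a -> lip e (ball a (3 * d)) u -> ball a d `<=` N.
  by move=> Aa hd z Bz; exists a, d.
have oN : open N.
  rewrite openE => z [a [d [Aa hd Bz]]]; have [s s0 sB] := open_ball (ball_open a d) Bz.
  by apply/nbhs_ballP; exists s => //; apply: subset_trans sB _; exact: Nball.
have NA a : A a -> N a.
  move=> Aa; have [d d0 hd] := uL Aa; exists a, (d / 3); split=> //.
    by rewrite mulrC divfK.
  by apply: ballxx; rewrite divr_gt0.
pose p := inradius N; pose D := dist A.
have D0 z : 0 <= D z by exact: dist_ge0.
have p0 z : 0 <= p z by exact: inradius_ge0.
have pN z : N z -> 0 < p z by exact: inradius_gt0.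
have uD z : N z -> `|u z| <= e * D z.
  move=> [a [d [Aa hd Bz]]]; apply/ler_addgt0Pl => k k0.
  have e10 : 0 < e + 1 by rewrite ltr_wpDl.
  have Dd : D z < d by move: Bz; rewrite ballE; apply: le_lt_trans; exact: dist_le.
  have [|b Ab] := @dist_lt _ _ _ A0 z (Num.min d (D z + k / (e + 1))).
    by rewrite lt_min Dd ltrDl divr_gt0.
  rewrite lt_min => /andP[zb zb'].
  have d0 : 0 < d by rewrite (le_lt_trans _ Dd).
  rewrite -[u z]subr0 -(uA Ab) (le_trans (hd z b _ _))//.
  - by apply: le_ball Bz; lra.
  - by move: Bz; rewrite !ballE; have := ler_distD z b a; rewrite (distrC b z); lra.
  - rewrite (le_trans (ler_wpM2l e_ge0 (ltW zb')))// [leRHS]addrC mulrDr lerD2l.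
    by rewrite mulrCA ler_piMr ?(ltW k0)// ler_pdivrMr// mul1r lerDl.
(* On [N] equal to [1] where [D <= p], hence near [A]; equal to [0] off [N]. *)
pose theta z := Num.min 1 (2 * (p z / (p z + D z))).
have th0 z : 0 <= theta z.
  by rewrite le_min ler01 mulr_ge0// divr_ge0// addr_ge0.
have th1 z : theta z <= 1 by rewrite ge_min lexx.
have thL y z : N y -> N z -> `|theta y - theta z| * D y <= 2 * `|y - z|.
  move=> Ny Nz; set q := `|y - z|.
  have minL (s t : R) : `|Num.min 1 s - Num.min 1 t| <= `|s - t|.
    by case: (leP 1 s); case: (leP 1 t); rewrite ?subrr ?normr0// => h1 h2;
      rewrite !ler_norml; have := ler_norm (s - t); have := ler_norm (t - s);
      rewrite (distrC t); lra.
  have [py pz] := (pN y Ny, pN z Nz).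
  have [sy sz] : 0 < p y + D y /\ 0 < p z + D z.
    by split; rewrite ltr_pwDl.
  have pq : `|p y - p z| <= q.
    rewrite ler_norml; have := inradius_triangle N y z.
    by have := inradius_triangle N z y; rewrite (distrC z) -/q -/p; lra.
  have Dq : `|D y - D z| <= q by have := @dist_lip _ _ _ A0 y z I I; rewrite mul1r.
  rewrite (le_trans (ler_wpM2r (D0 y) (minL _ _)))//.
  rewrite -mulrBr normrM (ger0_norm (x := 2))// -mulrA ler_pM2l//.
  have -> : p y / (p y + D y) - p z / (p z + D z) =
     ((p y - p z) * D z - p z * (D y - D z)) / (p z + D z) / (p y + D y).
    by field; rewrite !gt_eqF.
  rewrite !normrM !normfV (gtr0_norm sy) (gtr0_norm sz).
  have num : `|(p y - p z) * D z - p z * (D y - D z)| <= q * (p z + D z).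
    rewrite (le_trans (ler_normB _ _))// !normrM mulrDr addrC lerD//.
      by rewrite mulrC (ger0_norm (p0 z)) ler_wpM2r.
    by rewrite (ger0_norm (D0 z)) ler_wpM2r.
  rewrite mulrAC ler_pdivrMr//; apply: ler_pM => //.
  - by rewrite divr_ge0// ltW.
  - by rewrite ler_pdivrMr.
  - by rewrite lerDr ltW.
pose v z := theta z *: u z.
have vN z : ~ N z -> v z = 0.
  by move=> nN; rewrite /v /theta /p inradius_notin// mul0r mulr0 min_r// scale0r.
have vp z : `|v z| <= 2 * e * p z.
  have [Nz|nN] := pselect (N z); last by rewrite vN// normr0 !mulr_ge0.
  have sz : 0 < p z + D z by rewrite ltr_pwDl// pN.
  rewrite normrZ ger0_norm//.
  apply: (@le_trans _ _ (2 * (p z / (p z + D z)) * (e * D z))).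
    by rewrite ler_pM// ?uD// ge_min lexx orbT.
  have -> : 2 * (p z / (p z + D z)) * (e * D z) = 2 * e * p z * (D z / (p z + D z)) by ring.
  by rewrite ler_piMr ?mulr_ge0// ler_pdivrMr// mul1r lerDr.
exists v; split.
- apply: lip_at_convex => // z _; have [Nz|nN] := pselect (N z); last first.
    exists 1 => // w _; rewrite (vN z nN) subr0 (le_trans (vp w))//.
    have := inradius_triangle N w z; rewrite (inradius_notin nN) add0r -/p => pw.
    by rewrite (le_trans (ler_wpM2l _ pw)) ?mulr_ge0// ler_wpM2r// ler_wpM2r// ler_nat.
  have [a [d [Aa hd Bz]]] := Nz.
  have [s s0 sB] := open_ball (ball_open a d) Bz.
  exists s => // w /sB Bw; have Nw : N w by exact: Nball Bw.
  have -> : v w - v z = (theta w - theta z) *: u w + theta z *: (u w - u z).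
    by rewrite /v; lmod.
  rewrite (le_trans (ler_normD _ _))// !normrZ.
  have d3 : d <= 3 * d.
    by move: Bz; rewrite ballE => /(le_lt_trans (normr_ge0 _)); lra.
  have h1 : `|u w - u z| <= e * `|w - z| by apply: hd; exact: le_ball d3 _ _.
  have h2 : `|theta z| * `|u w - u z| <= e * `|w - z|.
    by rewrite (le_trans _ h1)// ler_piMl// ger0_norm.
  have h3 : `|theta w - theta z| * `|u w| <= 2 * e * `|w - z|.
    rewrite (le_trans (ler_wpM2l _ (uD w Nw)))// mulrCA [leRHS]mulrAC mulrC.
    by rewrite ler_wpM2r// thL.
  lra.
- by move=> a Aa; rewrite /v uA// scaler0.
- move=> a Aa; have pa := pN a (NA a Aa).
  exists (p a / 2); first by rewrite divr_gt0.
  move=> y; rewrite ballE => ya; have := inradius_triangle N a y; rewrite -/p distrC => h.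
  have Dy : D y <= `|y - a| by exact: dist_le.
  have py : 0 < p y by lra.
  have sy : 0 < p y + D y by rewrite ltr_pwDl.
  rewrite /v /theta min_l ?scale1r// mulrA ler_pdivlMr// mul1r; lra.
Qed.

End Truncation.

Section ExactExtension.
Context {R : realType}.

Lemma half_pow_small (c e : R) : 0 < e -> exists n : nat, c * 2^-1 ^+ n < e.
Proof.
move=> e0; have [c0|c0] := leP c 0.
  by exists 0%N; rewrite expr0 mulr1 (le_lt_trans c0).
have [n h] : exists n : nat, c / e < n%:R.
  by exists (Num.truncn (c / e)).+1; exact: truncnS_gt.
exists n.
have n0 : 0 < (2 ^ n)%:R :> R by rewrite ltr0n expn_gt0.
rewrite exprVn -natrX ltr_pdivrMr// mulrC -ltr_pdivrMr// (lt_trans h)// ltr_nat.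
exact: ltn_expl.
Qed.

Lemma half_pow_limit (Y : completeNormedModType R) (s : nat -> Y) (c : R) :
  (forall m k, (m <= k)%N -> `|s k - s m| <= c * 2^-1 ^+ m) ->
  exists l, forall m, `|l - s m| <= c * 2^-1 ^+ m.
Proof.
move=> h.
have cF : cauchy (s @ \oo).
  apply: cauchy_exP => e e0; have [n hn] := half_pow_small c e0.
  exists (s n); exists n => // k /= nk; rewrite ballE.
  exact: le_lt_trans (h _ _ nk) hn.
have [l sl] := (cvg_ex _).1 (cauchy_cvg _ cF).
exists l => m; apply/ler_addgt0Pl => e e0.
move: sl => /cvgrPdist_le/(_ _ e0) [n _ hn].
rewrite -(subrK (s (maxn n m)) l) -addrA (le_trans (ler_normD _ _))// lerD//.
  by apply: hn; rewrite /= leq_maxl.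
by apply: h; rewrite leq_maxr.
Qed.

Context {X : normedModType R} {Y : completeNormedModType R}.
Variables (A : set X) (f : X -> Y) (G : X -> clin X Y).
Hypothesis A0 : A !=set0.

(** Extensions with derivative error [2^-1 ^+ n] near [A] are joined into one
    whose derivative error vanishes on [A]: the differences of consecutive ones
    are truncated to globally Lipschitz maps, whose sum converges. *)
Lemma exact_extension :
  (forall e : R, 0 < e -> exists g : X -> Y,
    (forall a, A a -> g a = f a) /\
    forall a, A a -> exists2 d : R, 0 < d & lip e (ball a d) (fun y => g y - G a y)) ->
  exists g : X -> Y, (forall a, A a -> g a = f a) /\
    forall a, A a -> sderiv g a (G a).
Proof.
move=> ext; pose t n : R := 2^-1 ^+ n.
have t0 n : 0 < t n by rewrite exprn_gt0.
have tS n : t n.+1 = t n / 2 by rewrite /t exprSr.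
have /choice[g hg] : forall n, exists g : X -> Y,
    (forall a, A a -> g a = f a) /\
    forall a, A a -> exists2 d : R, 0 < d & lip (t n) (ball a d) (fun y => g y - G a y).
  by move=> n; exact: ext.
have /choice[v hv] : forall n, exists v : X -> Y, [/\ lip (6 * t n) setT v,
    forall a, A a -> v a = 0 &
    forall a, A a -> exists2 d : R, 0 < d &
      forall y, ball a d y -> v y = g n.+1 y - g n y].
  move=> n; have [g1 g2] := hg n; have [g1' g2'] := hg n.+1.
  have [|a Aa|a Aa|v [v1 v2 v3]] := @truncation R X Y A (fun y => g n.+1 y - g n y) (2 * t n) A0.
  - by rewrite mulr_ge0// ltW.
  - by rewrite g1// g1'// subrr.
  - have [d d0 hd] := g2 a Aa; have [d' d'0 hd'] := g2' a Aa.
    exists (Num.min d d'); first by rewrite lt_min d0.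
    apply: (lip_ext (f := fun y => (g n.+1 y - G a y) - (g n y - G a y))).
      by move=> y _; lmod.
    apply: (@lipW _ _ _ (t n.+1 + t n)); first by rewrite tS; have := t0 n; lra.
    apply: lipB.
      by apply: lip_sub hd'; apply: le_ball; rewrite ge_min lexx orbT.
    by apply: lip_sub hd; apply: le_ball; rewrite ge_min lexx.
  - by exists v; split=> //; move: v1; rewrite mulrA -natrM.
(* Near each point of [A] the truncations change nothing, and [s m] telescopes
   to [g m]. *)
pose s m y := g 0%N y + \sum_(n < m) v n y.
(* The constants [6 * t n] for [m <= n < k] add up to [12 * (t m - t k)]. *)
have sL m k : (m <= k)%N -> lip (12 * (t m - t k)) setT (fun y => s k y - s m y).
  move=> /subnK <-; elim: (k - m)%N => [|j ih].
    by move=> y z _ _; rewrite add0n !subrr normr0 mulr0 mul0r.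
  have [vL _ _] := hv (j + m)%N.
  apply: (lip_ext (f := fun y => (s (j + m)%N y - s m y) + v (j + m)%N y)).
    by move=> y _; rewrite /s addSn big_ord_recr/=; lmod.
  apply: lipW (lipD ih vL); rewrite addSn tS; have := t0 (j + m)%N; lra.
have sA m a : A a -> s m a = f a.
  move=> Aa; rewrite /s; have [-> // _] := hg 0%N.
  by rewrite big1 ?addr0// => n _; have [_ ->] := hv n.
have sloc m a : A a -> exists2 d : R, 0 < d & forall y, ball a d y -> s m y = g m y.
  move=> Aa; elim: m => [|m [d d0 ih]].
    by exists 1 => // y _; rewrite /s big_ord0 addr0.
  have [_ _ /(_ a Aa)[d' d'0 hd']] := hv m.
  exists (Num.min d d'); first by rewrite lt_min d0.
  move=> y; rewrite ballE lt_min => /andP[yd yd'].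
  have := ih y; rewrite ballE => /(_ yd); rewrite /s big_ord_recr/= addrA => ->.
  by rewrite hd' ?ballE// subrKC.
have [a0 Aa0] := A0.
have /choice[h hh] : forall y, exists l, forall m, `|l - s m y| <= 12 * `|y - a0| * t m.
  move=> y; apply: half_pow_limit => m k mk.
  have := sL m k mk y a0 I I; rewrite /= !(sA _ _ Aa0) subrr subr0 => /le_trans; apply.
  by rewrite mulrAC ler_wpM2l ?mulr_ge0// gerBl ltW.
have hL m : lip (12 * t m) setT (fun y => h y - s m y).
  move=> y z _ _; apply/ler_addgt0Pl => e e0.
  have [k hk] := half_pow_small (12 * `|y - a0| + 12 * `|z - a0|) e0.
  have hk' : (12 * `|y - a0| + 12 * `|z - a0|) * t (k + m)%N <= e.
    rewrite (le_trans _ (ltW hk))// ler_wpM2l ?addr_ge0 ?mulr_ge0//.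
    by rewrite /t exprD ler_piMr ?exprn_ge0// exprn_ile1// invf_le1// ler1n.
  have -> : h y - s m y - (h z - s m z) =
     (h y - s (k + m)%N y) - (h z - s (k + m)%N z) +
     ((s (k + m)%N y - s m y) - (s (k + m)%N z - s m z)) by lmod.
  rewrite (le_trans (ler_normD _ _))// lerD//.
    rewrite (le_trans (ler_normB _ _))// (le_trans _ hk')// mulrDl.
    by apply: lerD; exact: hh.
  rewrite (le_trans (sL m (k + m)%N (leq_addl _ _) y z I I))// ler_wpM2r//.
  by have := t0 (k + m)%N; lra.
exists h; split=> a Aa.
  apply/eqP; rewrite -subr_eq0 -normr_le0; apply/ler_addgt0Pl => e e0; rewrite addr0.
  have [k hk] := half_pow_small (12 * `|a - a0|) e0.
  by rewrite -(sA k a Aa) (le_trans (hh a k))// ltW.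
move=> e e0; have [m hm] := half_pow_small 13 e0.
have [_ /(_ a Aa)[d d0 hd]] := hg m; have [d' d'0 hd'] := sloc m a Aa.
exists (Num.min d d'); first by rewrite lt_min d0.
apply: (lip_ext (f := fun y => (h y - s m y) + (g m y - G a y))).
  move=> y; rewrite ballE lt_min => /andP[_ yd'].
  by rewrite hd' ?ballE//; lmod.
apply: (@lipW _ _ _ (12 * t m + t m)); first by move: hm; rewrite -/(t m); lra.
apply: lipD; first by move=> y z _ _; exact: hL.
by apply: lip_sub hd; apply: le_ball; rewrite ge_min lexx.
Qed.

End ExactExtension.

(** * Smoothing off a closed set *)

Section Smoothing.
Context {R : realType} {X : normedModType R} {Y : completeNormedModType R}.
Variables (C : R) (e0 : Y).
Hypotheses (C0 : 0 <= C) (hLA : ball_approximation X Y C) (e0_neq0 : e0 != 0).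
Variables (A : set X) (g : X -> Y) (G : X -> clin X Y).
Hypotheses (cA : closed A) (A0 : A !=set0).
Hypothesis gG : forall a, A a -> sderiv g a (G a).

Let D := dist A.
Let V x := ball x (D x / 2).

(** Subtracting from [g] a linear map that makes the Lipschitz constant on the
    ball almost minimal, smoothing, and adding it back, gives a map that is
    close to every linear map [T] to which [g] is close. *)
Lemma local_smoothing (x : X) (eta : R) : 0 < D x -> 0 < eta ->
  exists q : X -> Y, (forall z, V x z -> sdiff q z) /\
    forall (T : clin X Y) (L : R), 0 <= L -> lip L (V x) (fun y => g y - T y) ->
      (forall z, V x z -> `|g z - q z| <= eta) /\
      lip ((C + 2) * (L + D x)) (V x) (fun y => q y - T y).
Proof.
move=> Dx eta0; have D20 : 0 < D x / 2 by rewrite divr_gt0.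
pose S := [set L : R | 0 <= L /\ exists T : clin X Y, lip L (V x) (fun y => g y - T y)].
have [[L1 SL1]|S0] := pselect (S !=set0); last first.
  exists (fun=> 0); split=> [z _|T L L0 TL]; first exact: sdiff_cst.
  by case: S0; exists L; split=> //; exists T.
have hS : has_inf S by split; [exists L1 | exists 0 => L []].
have [L0 [L00 [T0 hT0]] L0D] := inf_adherent Dx hS.
have [q [qL qs qe]] := hLA D20 L00 eta0 hT0.
exists (fun y => q y + T0 y); split=> [z Vz|T L Lge0 TL].
  by apply: sdiffD; [exact: qs | exact: sdiff_clin].
have L0L : L0 <= L + D x.
  have : inf S <= L by apply: ge_inf; [exists 0 => ? [] | split=> //; exists T].
  by have := ltW L0D; lra.
split=> [z Vz|].
  by rewrite opprD addrA addrAC; exact: qe.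
apply: (lip_ext (f := fun y => q y + ((g y - T y) - (g y - T0 y)))).
  by move=> y _; lmod.
apply: lipW (lipD qL (lipB TL hT0)).
have : C * L0 <= C * (L + D x) by exact: ler_wpM2l.
by rewrite mulrDl; lra.
Qed.

Let near_radius x z : V x z -> D x <= 2 * D z.
Proof.
rewrite /V ballE => xz; have := dist_triangle A0 x z; rewrite -/D distrC; lra.
Qed.

Let D_gt0 z : ~ A z -> 0 < D z.
Proof. exact: dist_gt0. Qed.

Let D_ge0 z : 0 <= D z.
Proof. exact: dist_ge0. Qed.

Let geo N : \sum_(n < N) 2^-1 ^+ n <= 2 :> R.
Proof.
suff -> : \sum_(n < N) 2^-1 ^+ n = 2 - 2 * 2^-1 ^+ N :> R.
  by rewrite gerBl mulr_ge0// exprn_ge0.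
elim: N => [|N ih]; first by rewrite big_ord0 expr0 mulr1 subrr.
by rewrite big_ord_recr/= ih exprS mulrA divff// mul1r; lra.
Qed.

(** A map that is small compared with [dist A] and Lipschitz off [A] is Lipschitz
    near points of [A]: if two points are closer to each other than to [A], the
    segment between them avoids [A]; otherwise the values themselves are small
    compared with the distance of the two points. *)
Lemma lip_across (u : X -> Y) (a : X) (r K : R) : A a -> 0 <= K ->
  (forall z, ball a r z -> `|u z| <= K * D z) ->
  (forall z, ball a r z -> ~ A z -> lip_at K u z) ->
  lip (3 * K) (ball a (r / 2)) u.
Proof.
move=> Aa K0 uD uL y z By Bz.
have Br w : ball a (r / 2) w -> ball a r w.
  apply: le_ball; move: By; rewrite ballE => /(le_lt_trans (normr_ge0 _)).
  by lra.
have [yz|yz] := ltP `|y - z| (D y).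
  have Dy : 0 < D y by exact: le_lt_trans yz.
  have /lip_at_ball uB : forall w, ball y (D y) w -> lip_at K u w.
    move=> w Bw; apply: uL => [|Aw].
      move: By Bw; rewrite !ballE => By Bw.
      have : D y <= `|y - a| by exact: dist_le.
      by have := ler_distD y w a; lra.
    have : D y <= `|y - w| by exact: dist_le.
    by move: Bw; rewrite ballE distrC; lra.
  rewrite (le_trans (uB _ _ (ballxx y Dy) _)) ?ballE 1?distrC//.
  by rewrite ler_wpM2r//; lra.
have h1 := uD y (Br y By); have h2 := uD z (Br z Bz).
have Dz : D z <= D y + `|y - z|.
  by have := dist_triangle A0 z y; rewrite -/D (distrC z).
have : K * D y <= K * `|y - z| by exact: ler_wpM2l.
have : K * D z <= K * (D y + `|y - z|) by exact: ler_wpM2l.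
by have := ler_normB (u y) (u z); rewrite mulrDr; lra.
Qed.

(** Off [A] the local smoothings [h' n x] of [g] on the balls [V x], whose radii are
    comparable with the distance to [A], are glued. The resulting [F] differs
    from [g] by little compared with [dist A], and near [a] in [A] both [F] and
    [g] are locally close to [G a]; hence [F] inherits the strict derivative
    [G a] from [g]. *)
Lemma smoothing : exists F : X -> Y, (forall a, A a -> F a = g a) /\
  forall z, sdiff F z.
Proof.
have oV x : open (V x) by exact: ball_open.
have [M M0 glue] := gluing C0 hLA e0_neq0 oV.
(* The first argument of the minimum makes the error negligible against [D]; the
   second makes the errors times the [M n] summable. *)
pose eta n x := D x * Num.min (D x) (2^-1 ^+ n / (M n + 1)).
have M1 n : 0 < M n + 1 by rewrite ltr_wpDl.
have eta_gt0 n x : 0 < D x -> 0 < eta n x.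
  by move=> Dx; rewrite mulr_gt0// lt_min Dx divr_gt0// exprn_gt0.
have etaD n x : eta n x <= D x * D x.
  by rewrite ler_wpM2l// ge_min lexx.
have etaM n x : M n * eta n x <= D x * 2^-1 ^+ n.
  rewrite mulrCA ler_wpM2l//.
  rewrite (@le_trans _ _ (M n * (2^-1 ^+ n / (M n + 1))))//.
    by rewrite ler_wpM2l// ge_min lexx orbT.
  rewrite mulrCA ler_piMr ?exprn_ge0//.
  by rewrite ler_pdivrMr// mul1r lerDl.
have /choice[h' hh'] : forall n, exists h : X -> X -> Y, forall x, 0 < D x ->
    (forall z, V x z -> sdiff (h x) z) /\
    forall (T : clin X Y) (L : R), 0 <= L -> lip L (V x) (fun y => g y - T y) ->
      (forall z, V x z -> `|g z - h x z| <= eta n x) /\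
      lip ((C + 2) * (L + D x)) (V x) (fun y => h x y - T y).
  move=> n; suff /choice[h hh] : forall x, exists q : X -> Y, 0 < D x ->
      (forall z, V x z -> sdiff q z) /\
      forall (T : clin X Y) (L : R), 0 <= L -> lip L (V x) (fun y => g y - T y) ->
        (forall z, V x z -> `|g z - q z| <= eta n x) /\
        lip ((C + 2) * (L + D x)) (V x) (fun y => q y - T y) by exists h.
  move=> x; have [Dx|nDx] := ltP 0 (D x); last by exists (fun=> 0).
  by have [q hq] := local_smoothing Dx (eta_gt0 n x Dx); exists q.
have [F0 hF0] := glue h'.
pose F z := if `[< A z >] then g z else F0 z.
have FA z : A z -> F z = g z by move=> Az; rewrite /F asboolT.
have FnA z : ~ A z -> F z = F0 z by move=> nAz; rewrite /F asboolF.
have loc z : ~ A z -> exists (N : nat) (d : R) (j : nat -> X) (psi : nat -> X -> R^o),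
   [/\ 0 < d /\ (forall n, (n < N)%N -> ball z d `<=` V (j n)),
     forall n y, 0 <= psi n y,
     forall n, lip (M n) setT (psi n) /\ forall y, sdiff (psi n) y,
     forall y, ball z d y -> \sum_(n < N) psi n y = 1 &
     forall y, ball z d y -> F y = \sum_(n < N) (psi n y : R) *: h' n (j n) y].
  move=> nAz; have [|N [d [j [psi [[d0 h1] h2 h3 h4 h5]]]]] := hF0 z.
    by exists z; apply: ballxx; rewrite divr_gt0// D_gt0.
  have [r r0 rA] := open_ball (closed_openC cA) nAz.
  have Bd y : ball z (Num.min d r) y -> ball z d y.
    by apply: le_ball; rewrite ge_min lexx.
  exists N, (Num.min d r), j, psi; split=> //.
  - split; first by rewrite lt_min d0.
    by move=> n nN y /Bd; exact: h1.
  - by move=> y /Bd; exact: h4.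
  - move=> y By; rewrite FnA; first by apply: h5; exact: Bd.
    by apply: rA; apply: le_ball By; rewrite ge_min lexx orbT.
exists F; split=> // z; have [Az|nAz] := pselect (A z); last first.
  have [N [d [j [psi [[d0 h1] h2 h3 h4 h5]]]]] := loc z nAz.
  apply: (sdiff_ext d0 (f := fun y => \sum_(n < N) (psi n y : R) *: h' n (j n) y)).
    by move=> y By; rewrite h5.
  apply: (sdiff_sum (h := fun n y => (psi n y : R) *: h' n (j n) y)) => n nN.
  have Vz : V (j n) z by apply: h1 => //; exact: ballxx.
  have Dj : 0 < D (j n).
    by move: Vz; rewrite /V ballE => /(le_lt_trans (normr_ge0 _)); lra.
  apply: sdiffZ; first by have [] := h3 n.
  by have [hs _] := hh' n _ Dj; exact: hs.
exists (G z) => e e_gt0.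
(* [3 * (C + 2) + 1] bounds the Lipschitz constants of the glued differences and
   [4] the contribution of the weights, in units of [s]. *)
have [K K0 KC] : exists2 K : R, 0 < K & 3 * (C + 2) + 5 <= K.
  exists (3 * (C + 2) + 5); last exact: lexx.
  by rewrite addr_gt0// mulr_gt0// ltr_wpDl.
have C2 : 0 < C + 2 by rewrite ltr_wpDl.
pose s := e / (3 * K + 1).
have s0 : 0 < s by rewrite divr_gt0//; lra.
have Ks : (3 * (C + 2) + 5) * s <= K * s by rewrite ler_wpM2r// ltW.
have Cs : 0 <= C * s by rewrite mulr_ge0// ltW.
have sE : 3 * (K * s) + s = e.
  by rewrite /s; field; rewrite gt_eqF//; lra.
have [d d0 hd] := gG Az s0.
(* For [y] in [ball z rho] the balls [V x] that contain [y] lie in [ball z d]. *)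
pose rho := Num.min (d / 4) s.
have rho0 : 0 < rho by rewrite lt_min divr_gt0.
have [rd rs] : rho <= d / 4 /\ rho <= s by rewrite !ge_min !lexx orbT.
have key y : ball z rho y -> ~ A y ->
    `|F y - g y| <= K * s * D y /\ lip_at (K * s) (fun y => F y - g y) y.
  move=> By nAy; have [N [r [j [psi [[r0 h1] h2 h3 h4 h5]]]]] := loc y nAy.
  have Dy : D y <= `|y - z| by exact: dist_le.
  have Drho : D y < rho by move: By; rewrite ballE; exact: le_lt_trans.
  pose b n x := h' n (j n) x - g x.
  have FgE x : ball y r x -> F x - g x = \sum_(n < N) (psi n x : R) *: b n x.
    move=> Bx; rewrite h5// -[g x in LHS]scale1r -(h4 x Bx) scaler_suml -sumrB.
    by apply: eq_bigr => n _; rewrite /b; lmod.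
  have Vjy n : (n < N)%N -> V (j n) y by move=> nN; apply: h1 => //; exact: ballxx.
  have Dj n : (n < N)%N -> 0 < D (j n) /\ D (j n) <= 2 * D y.
    move=> nN; have Vj := Vjy n nN; split; last exact: near_radius.
    by move: Vj; rewrite /V ballE => /(le_lt_trans (normr_ge0 _)); lra.
  have Vd n : (n < N)%N -> V (j n) `<=` ball z d.
    move=> nN x; have := Vjy n nN; have [_ Djy] := Dj n nN; move: By.
    rewrite /V !ballE => yz yj xj; have := ler_distD y x z.
    by have := ler_distD (j n) x y; rewrite (distrC (j n) y); lra.
  have hn n : (n < N)%N -> (forall x, V (j n) x -> `|g x - h' n (j n) x| <= eta n (j n)) /\
      lip ((C + 2) * (s + D (j n))) (V (j n)) (fun x => h' n (j n) x - G z x).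
    move=> nN; have [Dj0 _] := Dj n nN; have [_ hT] := hh' n _ Dj0.
    by apply: hT; [exact: ltW | apply: lip_sub hd; exact: Vd].
  have bL n : (n < N)%N -> lip ((3 * (C + 2) + 1) * s) (ball y r) (b n).
    move=> nN; have [_ hL] := hn n nN; have [_ Djy] := Dj n nN.
    apply: (lip_ext (f := fun x => (h' n (j n) x - G z x) - (g x - G z x))).
      by move=> x _; rewrite /b; lmod.
    apply: (@lipW _ _ _ ((C + 2) * (s + D (j n)) + s)).
      have : (C + 2) * (s + D (j n)) <= (C + 2) * (3 * s) by rewrite ler_pM2l; lra.
      by lra.
    apply: lipB; first by apply: lip_sub hL; exact: h1.
    by apply: lip_sub hd; apply: subset_trans (Vd n nN); exact: h1.
  have bE n : (n < N)%N -> forall x, ball y r x -> `|b n x| <= eta n (j n).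
    move=> nN x Bx; have [hE _] := hn n nN; rewrite -normrN opprB.
    by apply: hE; exact: h1 Bx.
  split.
    rewrite FgE; last exact: ballxx.
    rewrite (le_trans (ler_norm_sum _ _ _))//.
    apply: (@le_trans _ _ (\sum_(n < N) (psi n y : R) * (4 * s * D y))).
      apply: ler_sum => n _; rewrite normrZ ger0_norm// ler_wpM2l//.
      rewrite (le_trans (bE n (ltn_ord n) y (ballxx y r0)))// (le_trans (etaD _ _))//.
      have [/ltW Dj0 Djy] := Dj n (ltn_ord n).
      apply: (@le_trans _ _ (2 * D y * (2 * D y))); first exact: ler_pM.
      have -> : 2 * D y * (2 * D y) = 4 * D y * D y by ring.
      rewrite ler_wpM2r//; lra.
    rewrite -mulr_suml (h4 y (ballxx y r0)) mul1r ler_wpM2r//; lra.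
  exists r => // x Bx; rewrite !FgE//; last exact: ballxx.
  have lw := lip_weighted_sum (B := ball y r) (L := (3 * (C + 2) + 1) * s)
    (beta := fun n => eta n (j n)) h2 h4 M0 (fun n => (h3 n).1) bL bE.
  rewrite (le_trans (lw _ _ Bx (ballxx y r0)))// ler_wpM2r//.
  have : \sum_(n < N) M n * eta n (j n) <= \sum_(n < N) (2 * D y) * 2^-1 ^+ n.
    apply: ler_sum => n _; rewrite (le_trans (etaM _ _))// ler_wpM2r ?exprn_ge0//.
    by have [] := Dj n (ltn_ord n).
  rewrite -mulr_sumr => /le_trans h6.
  have : 2 * D y * (\sum_(n < N) 2^-1 ^+ n) <= 2 * D y * 2.
    by rewrite ler_wpM2l ?geo// mulr_ge0// D_ge0.
  by move=> /h6; lra.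
have rho20 : 0 < rho / 2 by rewrite divr_gt0.
have Ks0 : 0 <= K * s by rewrite mulr_ge0// ltW.
exists (rho / 2) => //.
apply: (lip_ext (f := fun y => (F y - g y) + (g y - G z y))).
  by move=> y _; lmod.
rewrite -sE; apply: lipD; last first.
  by apply: lip_sub hd; apply: le_ball; lra.
apply: (lip_across Az) => // y By; last by move=> nAy; have [] := key y By nAy.
have [Ay|nAy] := pselect (A y); last by have [] := key y By nAy.
by rewrite FA// subrr normr0 mulr_ge0.
Qed.

End Smoothing.

(** * The extension theorem *)

Section Main.
Context {R : realType} {X : normedModType R} {Y : completeNormedModType R}.

(** If [A] is empty or [Y] is trivial the zero map will do; otherwise a nonzero
    vector of [Y] gives access to scalar bump functions. *)
Theorem whitney_extension (A : set X) (f : X -> Y) (G : X -> clin X Y) :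
  LA (Some 1%N) X Y -> closed A -> LLE A Y -> cont_on A G -> whitney A f G ->
  exists F : X -> Y, Ck (Some 1%N) setT F /\ forall a, A a -> F a = f a.
Proof.
move=> hLA cA hLLE Gc fW.
have zero : (forall a, A a -> f a = 0) ->
    exists F : X -> Y, Ck (Some 1%N) setT F /\ forall a, A a -> F a = f a.
  move=> f0; exists (fun=> 0); split=> [|a /f0//].
  by apply: sdiff_Ck1 => [|x _]; [exact: openT | exact: sdiff_cst].
have [A0|A0] := pselect (A !=set0); last first.
  by apply: zero => a Aa; case: A0; exists a.
have [[e0 e0_neq0]|Y0] := pselect (exists e0 : Y, e0 != 0); last first.
  by apply: zero => a _; apply/eqP/negP => /negP fa; apply: Y0; exists (f a).
have [C C0 hC] := LA_ball hLA.
have [g [gf gG]] := exact_extension A0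
  (approximate_extension C0 hC e0_neq0 hLLE Gc fW).
have [F [Fg Fs]] := smoothing C0 hC e0_neq0 cA A0 gG.
exists F; split=> [|a Aa]; last by rewrite Fg// gf.
by apply: sdiff_Ck1 => [|x _]; [exact: openT | exact: Fs].
Qed.

Lemma C1_extension_frechet (U : set X) (f F : X -> Y) : open U ->
  Ck (Some 1%N) setT F -> (forall x, U x -> F x = f x) ->
  {within closure U, continuous (frechet F)} /\
  forall x, U x -> frechet F x = frechet f x.
Proof.
move=> oU FC Ff; split=> [|x Ux].
  have [_ Fc] := FC; exact: continuous_subspaceW (@subsetT _ _) Fc.
have [r r0 rU] := open_ball oU Ux.
have Fx := Ck1_sderiv openT FC (I : setT x).
have [_ ->//] := sderiv_frechet (sderiv_ext r0 (fun y By => Ff y (rU y By)) Fx).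
Qed.

End Main.

Theorem proposition47 (R : realType) (X : normedModType R)
    (Y : completeNormedModType R) (hLA : LA (Some 1%N) X Y)
    (U : set X) (hU : open U) (hWQ : WQ U) (hLLE : LLE (closure U) Y)
    (f : X -> Y) (hf : Ck (Some 1%N) U f) :
  (exists F : X -> Y,
     Ck (Some 1%N) setT F /\ forall x, U x -> F x = f x)
  <->
  (exists G : X -> clin X Y,
     {within closure U, continuous G} /\ forall x, U x -> G x = frechet f x).
Proof.
split=> [[F [FC Ff]]|[G [/cont_onE Gc Gf]]].
  by exists (frechet F); exact: C1_extension_frechet.
have [fb [fbf fbW]] := whitney_closure hU hWQ hf Gf Gc.
have [F [FC Ffb]] := whitney_extension hLA (@closed_closure _ U) hLLE Gc fbW.
exists F; split=> // x Ux; rewrite Ffb ?fbf//; exact: subset_closure.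
Qed.
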